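(* Let $\mathbf K$ be a 2-category which admits the construction of vector fields, and assume that for each tangentad $(\mathbb X,\mathbb T)$ of $\mathbf K$ and each positive integer $n$ the $n$-fold 2-pullback $\mathrm{VF}_n(\mathbb X,\mathbb T)$ of $U:\mathrm{VF}(\mathbb X,\mathbb T)\to(\mathbb X,\mathbb T)$ along itself exists in $\mathbf K$. Then $U$, equipped with the strict tangent morphisms $0:(\mathbb X,\mathbb T)\to\mathrm{VF}(\mathbb X,\mathbb T)$ (zero morphism) and $+:\mathrm{VF}_2(\mathbb X,\mathbb T)\to\mathrm{VF}(\mathbb X,\mathbb T)$ (sum morphism), is an additive bundle in $\mathsf{Tng}_=(\mathbf K)$.
   Context: Let $\mathbf K$ be a 2-category. For a 2-morphism $\varphi$ and a 1-morphism $H$, write $H\varphi$ and $\varphi_H$ for the whiskerings (post- and precomposition with $H$). A pullback in $\mathbf K(\mathbb X,\mathbb Y)$ is pointwise if it is preserved by $\mathbf K(F,\mathbb Y)$ for every 1-morphism $F:\mathbb X'\to\mathbb X$. Tangentad: a tangentad $(\mathbb X,\mathbb T)$ in $\mathbf K$ is an object $\mathbb X$ with a tangent structure $\mathbb T=(T,p,z,s,l,c)$: a 1-morphism $T:\mathbb X\to\mathbb X$ and 2-morphisms $p:T\Rightarrow\mathrm{id}$, $z:\mathrm{id}\Rightarrow T$, $s:T_2\Rightarrow T$, $l:T\Rightarrow T^2$, $c:T^2\Rightarrow T^2$ such that: (1) for each $n\ge1$ the $n$-fold pullback $T_n$ of $p$ along itself (projections $\pi_k:T_n\Rightarrow T$)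 exists in $\mathbf K(\mathbb X,\mathbb X)$, is pointwise, and is preserved by postcomposition with all iterates $T^m$; (2) $pz=\mathrm{id}$, $ps=p\pi_1$, and $s$ is associative, commutative and unital with unit $z$; (3) $Tp\circ l=z\circ p$, $l\circ z=Tz\circ z$, $l\circ s=Ts\circ\langle l\pi_1,l\pi_2\rangle$; (4) $p_T\circ c=Tp$, $c\circ Tz=z_T$, $c\circ Ts=s_T\circ\langle c\circ T\pi_1,c\circ T\pi_2\rangle$; (5) $Tl\circ l=l_T\circ l$, $c\circ l=l$, $c_T\circ Tc\circ l_T=Tl\circ c$, $c\circ c=\mathrm{id}$, $Tc\circ c_T\circ Tc=c_T\circ Tc\circ c_T$; (6) the square with top $Ts\circ\langle l\pi_1,z_T\pi_2\rangle:T_2\Rightarrow T^2$, left side $p\pi_1:T_2\Rightarrow\mathrm{id}$, right side $Tp:T^2\Rightarrow T$ and bottom $z:\mathrm{id}\Rightarrow T$ is a pointwise pullback. A tangent category is a tangentad in the 2-category $\mathsf{Cat}$. Morphisms: a lax tangent morphism $(F,\alpha):(\mathbb X,\mathbb T)\to(\mathbb X',\mathbb T')$ is a 1-morphism $F:\mathbb X\to\mathbb X'$ with a 2-morphism $\alpha:F\circ T\Rightarrow T'\circ F$ such that $p'_F\circ\alpha=Fp$, $\alpha\circ Fz=z'_F$, $\alpha\circ Fs=s'_F\circ\langle\alpha\circ F\pi_1,\alpha\circ F\pi_2\rangle$, $l'_F\circ\alpha=T'\alpha\circ\alpha_T\circ Fl$, $c'_F\circ T'\alpha\circ\alpha_T=T'\alpha\circ\alpha_T\circ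 Fc$. It is strong if $\alpha$ is invertible, strict if $\alpha$ is an identity. A tangent 2-morphism $\varphi:(F,\alpha)\Rightarrow(G,\beta)$ is a 2-morphism $\varphi:F\Rightarrow G$ with $T'\varphi\circ\alpha=\beta\circ\varphi_T$. $\mathsf{Tng}(\mathbf K)$ (resp. $\mathsf{Tng}_=(\mathbf K)$) is the 2-category of tangentads of $\mathbf K$, lax (resp. strict) tangent morphisms and tangent 2-morphisms. Hom-tangent category: $[\mathbb X',\mathbb T'\mid\mathbb X,\mathbb T]$ is the category $\mathsf{Tng}(\mathbf K)((\mathbb X',\mathbb T'),(\mathbb X,\mathbb T))$ with the pointwise tangent structure: $\bar T(F,\alpha)=(T,c)\circ(F,\alpha)=(T\circ F,c_F\circ T\alpha)$, $\bar T\varphi=T\varphi$, structural transformations $p_F,z_F,s_F,l_F,c_F$. Vector fields: a vector field on an object $M$ of a tangent category is $v:M\to TM$ with $p_M\circ v=\mathrm{id}_M$. The sum of vector fields $u,v$ on $M$ is $u+v=s\circ\langle u,v\rangle$. For a tangent category $(\mathbb Y,\mathbb T)$, $\mathrm{VF}(\mathbb Y,\mathbb T)$ is the tangent category of pairs $(M,v)$, $v$ a vector field on $M$; morphisms $f:(M,v)\to(N,u)$ are $f:M\to N$ with $Tf\circ v=u\circ f$; tangent bundle functor $(M,v)\mapsto(TM,c_M\circ Tv)$, $f\mapsto Tf$; structural transformations as in $(\mathbb Y,\mathbb T)$. $\mathrm{VF}[\mathbb X',\mathbb T'\mid\mathbb X,\mathbb T]$ is this construction applied to the Hom-tangent category.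 Construction of vector fields: for a strict tangent morphism $U:(\mathbb V,\mathbb T^{\mathbb V})\to(\mathbb X,\mathbb T)$ and a vector field $\mathbf v:U\Rightarrow\bar TU$ on $U$ in $[\mathbb V,\mathbb T^{\mathbb V}\mid\mathbb X,\mathbb T]$, for each tangentad $(\mathbb X',\mathbb T')$ let $\Gamma_{\mathbf v}:[\mathbb X',\mathbb T'\mid\mathbb V,\mathbb T^{\mathbb V}]\to\mathrm{VF}[\mathbb X',\mathbb T'\mid\mathbb X,\mathbb T]$ be the strict tangent morphism $(H,\gamma)\mapsto(U\circ(H,\gamma),\mathbf v_H)$, $\varphi\mapsto U\varphi$. A tangentad $(\mathbb X,\mathbb T)$ admits the construction of vector fields if there are a tangentad $\mathrm{VF}(\mathbb X,\mathbb T)$ (the tangentad of vector fields), a strict tangent morphism $U:\mathrm{VF}(\mathbb X,\mathbb T)\to(\mathbb X,\mathbb T)$ and a vector field $\mathbf v$ on $U$ in $[\mathrm{VF}(\mathbb X,\mathbb T)\mid\mathbb X,\mathbb T]$ (the universal vector field) such that $\Gamma_{\mathbf v}$ is invertible for every $(\mathbb X',\mathbb T')$. $\mathbf K$ admits the construction of vector fields if every tangentad of $\mathbf K$ does. The 2-pullbacks $\mathrm{VF}_n(\mathbb X,\mathbb T)$ carry an induced tangent structure making them $n$-fold 2-pullbacks in $\mathsf{Tng}(\mathbf K)$ with strict projections $\pi_k:\mathrm{VF}_n(\mathbb X,\mathbb T)\to\mathrm{VF}(\mathbb X,\mathbb T)$. The morphism $0:(\mathbb X,\mathbb T)\to\mathrm{VF}(\mathbb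 X,\mathbb T)$ is the tangent morphism corresponding under $\Gamma_{\mathbf v}$ to the vector field $z:\mathrm{id}_{(\mathbb X,\mathbb T)}\Rightarrow(T,c)$ on the identity in $[\mathbb X,\mathbb T\mid\mathbb X,\mathbb T]$. Writing $\mathbf v_k=\mathbf v_{\pi_k}=\Gamma_{\mathbf v}(\pi_k)$, the vector fields $\mathbf v_1,\mathbf v_2$ on $U\circ\pi_1=U\circ\pi_2$ in $[\mathrm{VF}_2(\mathbb X,\mathbb T)\mid\mathbb X,\mathbb T]$ have a sum $\mathbf v_1+\mathbf v_2$, and $+:\mathrm{VF}_2(\mathbb X,\mathbb T)\to\mathrm{VF}(\mathbb X,\mathbb T)$ is the tangent morphism corresponding to it under $\Gamma_{\mathbf v}$. Both $0$ and $+$ are strict. Additive bundle: in a category, an additive bundle consists of morphisms $q:E\to B$, $z_q:B\to E$, $s_q:E_2\to E$ such that all $n$-fold pullbacks $E_n$ of $q$ along itself exist, $q z_q=\mathrm{id}_B$, $q s_q=q\pi_1$, and $s_q$ is associative, commutative, and unital with unit $z_q$ (i.e. $s_q\circ\langle z_q\circ q,\mathrm{id}_E\rangle=\mathrm{id}_E$). *)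

(* Defs.v *)
From mathcomp Require Import all_boot.
From mathcomp Require Import boolp.
From Stdlib Require Import ClassicalEpsilon.

Set Implicit Arguments.
Unset Strict Implicit.
Unset Printing Implicit Defensive.

Declare Scope twocat_scope.
Delimit Scope twocat_scope with K2.

(* The 2-morphisms between 1-morphisms X -> Y form one type [cell X Y], with a
   source and a target, rather than a family indexed by the 1-morphisms.
   Composition of 1-morphisms is associative only up to propositional equality,
   so with an indexed family most of the equations between pastings below would
   need transports.  Vertical composition is total, but it is axiomatised (and
   used) only on composable pairs; on the other pairs its value is arbitrary. *)
Record twoCat := TwoCat {
  obj :> Type;
  mor : obj -> obj -> Type;
  cell : obj -> obj -> Type;
  src : forall X Y, cell X Y -> mor X Y;
  tgt : forall X Y, cell X Y -> mor X Y;
  id1 : forall X, mor X X;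
  comp1 : forall X Y Z, mor Y Z -> mor X Y -> mor X Z;
  id2 : forall X Y, mor X Y -> cell X Y;
  vcomp : forall X Y, cell X Y -> cell X Y -> cell X Y;
  hcomp : forall X Y Z, cell Y Z -> cell X Y -> cell X Z;
  comp1A : forall X Y Z W (H : mor Z W) (G : mor Y Z) (F : mor X Y),
    comp1 H (comp1 G F) = comp1 (comp1 H G) F;
  comp1l : forall X Y (F : mor X Y), comp1 (id1 Y) F = F;
  comp1r : forall X Y (F : mor X Y), comp1 F (id1 X) = F;
  src_id2 : forall X Y (F : mor X Y), src (id2 F) = F;
  tgt_id2 : forall X Y (F : mor X Y), tgt (id2 F) = F;
  src_vcomp : forall X Y (b a : cell X Y),
    tgt a = src b -> src (vcomp b a) = src a;
  tgt_vcomp : forall X Y (b a : cell X Y),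
    tgt a = src b -> tgt (vcomp b a) = tgt b;
  vcompA : forall X Y (c b a : cell X Y),
    tgt a = src b -> tgt b = src c ->
    vcomp c (vcomp b a) = vcomp (vcomp c b) a;
  vcompl : forall X Y (a : cell X Y), vcomp (id2 (tgt a)) a = a;
  vcompr : forall X Y (a : cell X Y), vcomp a (id2 (src a)) = a;
  src_hcomp : forall X Y Z (b : cell Y Z) (a : cell X Y),
    src (hcomp b a) = comp1 (src b) (src a);
  tgt_hcomp : forall X Y Z (b : cell Y Z) (a : cell X Y),
    tgt (hcomp b a) = comp1 (tgt b) (tgt a);
  hcompA : forall X Y Z W (c : cell Z W) (b : cell Y Z) (a : cell X Y),
    hcomp c (hcomp b a) = hcomp (hcomp c b) a;
  hcompl : forall X Y (a : cell X Y), hcomp (id2 (id1 Y)) a = a;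
  hcompr : forall X Y (a : cell X Y), hcomp a (id2 (id1 X)) = a;
  hcomp_id2 : forall X Y Z (G : mor Y Z) (F : mor X Y),
    hcomp (id2 G) (id2 F) = id2 (comp1 G F);
  interchange : forall X Y Z (b' b : cell Y Z) (a' a : cell X Y),
    tgt b = src b' -> tgt a = src a' ->
    hcomp (vcomp b' b) (vcomp a' a) = vcomp (hcomp b' a') (hcomp b a)
}.

Arguments id1 {t}.

Definition lwhisk (K : twoCat) (X Y Z : K) (H : mor Y Z) (a : cell X Y) :
  cell X Z := hcomp (id2 H) a.

Definition rwhisk (K : twoCat) (X Y Z : K) (a : cell Y Z) (H : mor X Y) :
  cell X Z := hcomp a (id2 H).

Reserved Notation "H <* a" (at level 40, left associativity).
Reserved Notation "a *> H" (at level 40, left associativity).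

Notation "G * F" := (comp1 G F) : twocat_scope.
Notation "b \o a" := (vcomp b a) : twocat_scope.
Notation "H <* a" := (lwhisk H a) : twocat_scope.
Notation "a *> H" := (rwhisk a H) : twocat_scope.

Local Open Scope twocat_scope.

(* a : F => G *)
Definition typed (K : twoCat) (X Y : K) (a : cell X Y) (F G : mor X Y) : Prop :=
  src a = F /\ tgt a = G.

Fixpoint iter1 (K : twoCat) (X : K) (T : mor X X) (m : nat) : mor X X :=
  if m is m'.+1 then T * iter1 T m' else id1 X.

(* Positive integers are written n.+1: a family of n-fold pullbacks indexed by
   the positive integers is a family over nat whose n-th member is an
   n.+1-fold pullback. *)

Definition is_nfold_pullback2 (K : twoCat) (X Y : K) (n : nat)
    (P : mor X Y) (pi : 'I_n.+1 -> cell X Y) (q : cell X Y) : Prop :=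
  [/\ forall k, typed (pi k) P (src q),
      forall i j, q \o pi i = q \o pi j
    & forall (G : mor X Y) (f : 'I_n.+1 -> cell X Y),
        (forall k, typed (f k) G (src q)) ->
        (forall i j, q \o f i = q \o f j) ->
        exists! h : cell X Y, typed h G P /\ forall k, pi k \o h = f k].

Definition is_pullback2 (K : twoCat) (X Y : K) (P : mor X Y)
    (a b f g : cell X Y) : Prop :=
  [/\ typed a P (src f), typed b P (src g), tgt f = tgt g, f \o a = g \o b
    & forall (G : mor X Y) (x y : cell X Y),
        typed x G (src f) -> typed y G (src g) -> f \o x = g \o y ->
        exists! h : cell X Y, [/\ typed h G P, a \o h = x & b \o h = y]].

(* Taking F to be the identity, a pointwise pullback is a pullback. *)
Definition pointwise_nfold_pullback2 (K : twoCat) (X Y : K) (n : nat)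
    (P : mor X Y) (pi : 'I_n.+1 -> cell X Y) (q : cell X Y) : Prop :=
  forall (X' : K) (F : mor X' X),
    is_nfold_pullback2 (P * F) (fun k => pi k *> F) (q *> F).

Definition pointwise_pullback2 (K : twoCat) (X Y : K) (P : mor X Y)
    (a b f g : cell X Y) : Prop :=
  forall (X' : K) (F : mor X' X),
    is_pullback2 (P * F) (a *> F) (b *> F) (f *> F) (g *> F).

(* <f, g>: the 2-morphism whose composites with the projections pi1 and pi2 of
   a pullback are f and g.  It is unspecified when there is none. *)
Definition pair2 (K : twoCat) (X Y : K) (pi1 pi2 f g : cell X Y) : cell X Y :=
  epsilon (inhabits f)
    (fun h => [/\ typed h (src f) (src pi1), pi1 \o h = f & pi2 \o h = g]).

(* The canonical functor from K(Z, P) to the n.+1-fold pullback of the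
   categories K(Z, E) over K(Z, B) is bijective on objects and on arrows. *)
Definition is_nfold_2pullback (K : twoCat) (E B P : K) (n : nat)
    (pi : 'I_n.+1 -> mor P E) (U : mor E B) : Prop :=
  [/\ forall i j, U * pi i = U * pi j,
      forall (Z : K) (F : 'I_n.+1 -> mor Z E),
        (forall i j, U * F i = U * F j) ->
        exists! H : mor Z P, forall k, pi k * H = F k
    & forall (Z : K) (a : 'I_n.+1 -> cell Z E),
        (forall i j, U <* a i = U <* a j) ->
        exists! b : cell Z P, forall k, pi k <* b = a k].

Section TangentStructure.
Variables (K : twoCat) (X : K).

(* [dTn n] is T_{n+1}, with projections [dpr]; so T_2 is [dTn 1]. *)
Record tangentData := TangentData {
  dT : mor X X;
  dTn : nat -> mor X X;
  dpr : forall n, 'I_n.+1 -> cell X X;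
  dp : cell X X;
  dz : cell X X;
  ds : cell X X;
  dl : cell X X;
  dc : cell X X
}.

Variable D : tangentData.

Let T := dT D.
Let T2 := dTn D 1.
Let T3 := dTn D 2.
Let p := dp D.
Let z := dz D.
Let s := ds D.
Let l := dl D.
Let c := dc D.
Let pi1 : cell X X := dpr D (@Ordinal 2 0 isT).
Let pi2 : cell X X := dpr D (@Ordinal 2 1 isT).
Let rho1 : cell X X := dpr D (@Ordinal 3 0 isT).
Let rho2 : cell X X := dpr D (@Ordinal 3 1 isT).
Let rho3 : cell X X := dpr D (@Ordinal 3 2 isT).

Record isTangent : Prop := IsTangent {
  p_typed : typed p T (id1 X);
  z_typed : typed z (id1 X) T;
  s_typed : typed s T2 T;
  l_typed : typed l T (T * T);
  c_typed : typed c (T * T) (T * T);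
  (* m = 0: the pullback itself; m > 0: its preservation by T^m, which is
     understood pointwise as well *)
  Tn_pullback : forall n m,
    pointwise_nfold_pullback2 (iter1 T m * dTn D n)
      (fun k : 'I_n.+1 => iter1 T m <* dpr D k) (iter1 T m <* p);
  pz : p \o z = id2 (id1 X);
  ps : p \o s = p \o pi1;
  s_assoc : s \o pair2 pi1 pi2 (s \o pair2 pi1 pi2 rho1 rho2) rho3 =
            s \o pair2 pi1 pi2 rho1 (s \o pair2 pi1 pi2 rho2 rho3);
  s_comm : s \o pair2 pi1 pi2 pi2 pi1 = s;
  s_unit : s \o pair2 pi1 pi2 (z \o p) (id2 T) = id2 T;
  Tp_l : T <* p \o l = z \o p;
  l_z : l \o z = T <* z \o z;
  l_s : l \o s =
        T <* s \o pair2 (T <* pi1) (T <* pi2) (l \o pi1) (l \o pi2);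
  pT_c : p *> T \o c = T <* p;
  c_Tz : c \o T <* z = z *> T;
  c_Ts : c \o T <* s =
         s *> T \o pair2 (pi1 *> T) (pi2 *> T) (c \o T <* pi1) (c \o T <* pi2);
  Tl_l : T <* l \o l = l *> T \o l;
  c_l : c \o l = l;
  c_Tc_l : c *> T \o T <* c \o l *> T = T <* l \o c;
  c_c : c \o c = id2 (T * T);
  Tc_c_Tc : T <* c \o c *> T \o T <* c = c *> T \o T <* c \o c *> T;
  lift_pullback :
    pointwise_pullback2 T2
      (T <* s \o pair2 (T <* pi1) (T <* pi2) (l \o pi1) (z *> T \o pi2))
      (p \o pi1) (T <* p) z
}.

End TangentStructure.

Record tangentStructure (K : twoCat) (X : K) := TangentStructure {
  tdata :> tangentData X;
  tangentP : isTangent tdata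
}.

Record tangentad (K : twoCat) := Tangentad {
  carrier :> K;
  tstruct : tangentStructure carrier
}.

Section Projections.
Variables (K : twoCat) (X : tangentad K).
Definition tT : mor X X := dT (tstruct X).
Definition tTn (n : nat) : mor X X := dTn (tstruct X) n.
Definition tpr (n : nat) (k : 'I_n.+1) : cell X X := dpr (tstruct X) k.
Definition tpi1 : cell X X := tpr (@Ordinal 2 0 isT).
Definition tpi2 : cell X X := tpr (@Ordinal 2 1 isT).
Definition tp : cell X X := dp (tstruct X).
Definition tz : cell X X := dz (tstruct X).
Definition ts : cell X X := ds (tstruct X).
Definition tl : cell X X := dl (tstruct X).
Definition tc : cell X X := dc (tstruct X).
End Projections.

Arguments tT {K} X.
Arguments tTn {K} X n.
Arguments tpr {K} X {n} k.
Arguments tpi1 {K} X.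
Arguments tpi2 {K} X.
Arguments tp {K} X.
Arguments tz {K} X.
Arguments ts {K} X.
Arguments tl {K} X.
Arguments tc {K} X.

Record isLax (K : twoCat) (X Y : tangentad K) (F : mor X Y) (a : cell X Y) :
    Prop := IsLax {
  lax_typed : typed a (F * tT X) (tT Y * F);
  lax_p : tp Y *> F \o a = F <* tp X;
  lax_z : a \o F <* tz X = tz Y *> F;
  lax_s : a \o F <* ts X =
    ts Y *> F \o pair2 (tpi1 Y *> F) (tpi2 Y *> F)
                       (a \o F <* tpi1 X) (a \o F <* tpi2 X);
  lax_l : tl Y *> F \o a = tT Y <* a \o a *> tT X \o F <* tl X;
  lax_c : tc Y *> F \o tT Y <* a \o a *> tT X =
          tT Y <* a \o a *> tT X \o F <* tc X
}.

Record lax (K : twoCat) (X Y : tangentad K) := Lax {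
  lmor :> mor X Y;
  lcell : cell X Y;
  laxP : isLax lmor lcell
}.

Definition is_strict (K : twoCat) (X Y : tangentad K) (F : lax X Y) : Prop :=
  lcell F = id2 (F * tT X).

Record strict (K : twoCat) (X Y : tangentad K) := Strict {
  slax :> lax X Y;
  strictP : is_strict slax
}.

Definition is_tangent2 (K : twoCat) (X Y : tangentad K) (F G : lax X Y)
    (a : cell X Y) : Prop :=
  typed a F G /\ tT Y <* a \o lcell F = lcell G \o a *> tT X.

Section Calculus.
Variable K : twoCat.
Implicit Types X Y Z W : K.

Lemma src_lw X Y Z (H : mor Y Z) (a : cell X Y) : src (H <* a) = H * src a.
Proof. by rewrite /lwhisk src_hcomp src_id2. Qed.

Lemma tgt_lw X Y Z (H : mor Y Z) (a : cell X Y) : tgt (H <* a) = H * tgt a.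
Proof. by rewrite /lwhisk tgt_hcomp tgt_id2. Qed.

Lemma src_rw X Y Z (a : cell Y Z) (H : mor X Y) : src (a *> H) = src a * H.
Proof. by rewrite /rwhisk src_hcomp src_id2. Qed.

Lemma tgt_rw X Y Z (a : cell Y Z) (H : mor X Y) : tgt (a *> H) = tgt a * H.
Proof. by rewrite /rwhisk tgt_hcomp tgt_id2. Qed.

Lemma vcomp_id2 X Y (F : mor X Y) : id2 F \o id2 F = id2 F.
Proof. by have := vcompl (id2 F); rewrite tgt_id2. Qed.

Lemma lw_vcomp X Y Z (H : mor Y Z) (b a : cell X Y) :
  tgt a = src b -> H <* (b \o a) = H <* b \o H <* a.
Proof.
by move=> e; rewrite /lwhisk -interchange ?vcomp_id2 // tgt_id2 src_id2.
Qed.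

Lemma rw_vcomp X Y Z (b a : cell Y Z) (H : mor X Y) :
  tgt a = src b -> (b \o a) *> H = b *> H \o a *> H.
Proof.
by move=> e; rewrite /rwhisk -interchange ?vcomp_id2 // tgt_id2 src_id2.
Qed.

Lemma lw_lw X Y Z W (H : mor Z W) (G : mor Y Z) (a : cell X Y) :
  H <* (G <* a) = (H * G) <* a.
Proof. by rewrite /lwhisk hcompA hcomp_id2. Qed.

Lemma rw_rw X Y Z W (a : cell Z W) (G : mor Y Z) (F : mor X Y) :
  (a *> G) *> F = a *> (G * F).
Proof. by rewrite /rwhisk -hcompA hcomp_id2. Qed.

Lemma lw_rw X Y Z W (H : mor Z W) (a : cell Y Z) (F : mor X Y) :
  H <* (a *> F) = (H <* a) *> F.
Proof. by rewrite /lwhisk /rwhisk hcompA. Qed.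

Lemma lw_id2 X Y Z (H : mor Y Z) (F : mor X Y) : H <* id2 F = id2 (H * F).
Proof. exact: hcomp_id2. Qed.

Lemma rw_id2 X Y Z (H : mor Y Z) (F : mor X Y) : id2 H *> F = id2 (H * F).
Proof. exact: hcomp_id2. Qed.

Lemma lw1 X Y (a : cell X Y) : id1 Y <* a = a.
Proof. exact: hcompl. Qed.

Lemma rw1 X Y (a : cell X Y) : a *> id1 X = a.
Proof. exact: hcompr. Qed.

Lemma whisk_exchange X Y Z (b : cell Y Z) (a : cell X Y) (F F' : mor X Y)
    (G G' : mor Y Z) : typed a F F' -> typed b G G' ->
  b *> F' \o G <* a = G' <* a \o b *> F.
Proof.
move=> [<- <-] [<- <-].
rewrite /lwhisk /rwhisk -!interchange ?src_id2 ?tgt_id2 //.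
by rewrite !vcompl !vcompr.
Qed.

Lemma typed_comp X Y (b a : cell X Y) (F G H : mor X Y) :
  typed b G H -> typed a F G -> typed (b \o a) F H.
Proof.
by move=> [sb tb] [sa ta]; split; rewrite ?src_vcomp ?tgt_vcomp // ta sb.
Qed.

Lemma typed_lw X Y Z (H : mor Y Z) (a : cell X Y) (F G : mor X Y) :
  typed a F G -> typed (H <* a) (H * F) (H * G).
Proof. by move=> [<- <-]; split; rewrite ?src_lw ?tgt_lw. Qed.

Lemma typed_rw X Y Z (a : cell Y Z) (H : mor X Y) (F G : mor Y Z) :
  typed a F G -> typed (a *> H) (F * H) (G * H).
Proof. by move=> [<- <-]; split; rewrite ?src_rw ?tgt_rw. Qed.

Lemma typed_id2 X Y (F : mor X Y) : typed (id2 F) F F.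
Proof. by split; rewrite ?src_id2 ?tgt_id2. Qed.

Lemma typed_tgt_src X Y (b a : cell X Y) (F G H : mor X Y) :
  typed a F G -> typed b G H -> tgt a = src b.
Proof. by move=> [_ ->] [-> _]. Qed.

Lemma vcomp_idl X Y (a : cell X Y) (F G : mor X Y) :
  typed a F G -> id2 G \o a = a.
Proof. by move=> [_ <-]; rewrite vcompl. Qed.

Lemma vcomp_idr X Y (a : cell X Y) (F G : mor X Y) :
  typed a F G -> a \o id2 F = a.
Proof. by move=> [<- _]; rewrite vcompr. Qed.

Lemma vA X Y (c b a : cell X Y) (F G H L : mor X Y) :
  typed a F G -> typed b G H -> typed c H L ->
  c \o (b \o a) = c \o b \o a.
Proof.
by move=> ta tb tc; apply: vcompA;
  [exact: typed_tgt_src ta tb | exact: typed_tgt_src tb tc].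
Qed.

Lemma lwv X Y Z (H : mor Y Z) (b a : cell X Y) (F G L : mor X Y) :
  typed a F G -> typed b G L -> H <* (b \o a) = H <* b \o H <* a.
Proof. by move=> ta tb; apply: lw_vcomp; exact: typed_tgt_src ta tb. Qed.

Lemma rwv X Y Z (H : mor X Y) (b a : cell Y Z) (F G L : mor Y Z) :
  typed a F G -> typed b G L -> (b \o a) *> H = b *> H \o a *> H.
Proof. by move=> ta tb; apply: rw_vcomp; exact: typed_tgt_src ta tb. Qed.

Lemma pair2P X Y (pi : 'I_2 -> cell X Y) (q : cell X Y) (P G : mor X Y)
    (f g : cell X Y) :
  is_nfold_pullback2 P pi q -> typed f G (src q) -> typed g G (src q) ->
  q \o f = q \o g ->
  let h := pair2 (pi (@Ordinal 2 0 isT)) (pi (@Ordinal 2 1 isT)) f g in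
  [/\ typed h G P, pi (@Ordinal 2 0 isT) \o h = f,
      pi (@Ordinal 2 1 isT) \o h = g
    & forall h', typed h' G P -> pi (@Ordinal 2 0 isT) \o h' = f ->
        pi (@Ordinal 2 1 isT) \o h' = g -> h' = h].
Proof.
move=> [tpi _ univ] tf tg efg.
pose F (k : 'I_2) := if k == 0 :> nat then f else g.
have tF k : typed (F k) G (src q) by rewrite /F; case: ifP.
have eF i j : q \o F i = q \o F j by rewrite /F; case: ifP; case: ifP.
have [h0 [[th0 eh0] uh0]] := univ G F tF eF.
have e0 := eh0 (@Ordinal 2 0 isT); have e1 := eh0 (@Ordinal 2 1 isT).
rewrite /F /= in e0 e1.
have uniqh h' : typed h' G P -> pi (@Ordinal 2 0 isT) \o h' = f ->
    pi (@Ordinal 2 1 isT) \o h' = g -> h' = h0.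
  move=> th' e0' e1'; apply/esym/uh0; split=> // k.
  by case: k => [[|[|k]] lk] //; rewrite (bool_irrelevance lk isT) /F.
rewrite /=; set h := pair2 _ _ _ _.
have [th ep1 ep2] : [/\ typed h (src f) (src (pi (@Ordinal 2 0 isT))),
    pi (@Ordinal 2 0 isT) \o h = f & pi (@Ordinal 2 1 isT) \o h = g].
  rewrite /h /pair2; apply epsilon_spec; exists h0.
  by split=> //; rewrite (proj1 tf) (proj1 (tpi _)).
rewrite (proj1 tf) (proj1 (tpi _)) in th.
split=> // h' th' e0' e1'.
by rewrite (uniqh _ th' e0' e1') (uniqh _ th ep1 ep2).
Qed.

End Calculus.


Section TangentadTheory.
Variables (K : twoCat) (X : tangentad K).
Let H := tangentP (tstruct X).

Lemma src_tp : src (tp X) = tT X. Proof. exact: (proj1 (p_typed H)). Qed.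
Lemma tgt_tp : tgt (tp X) = id1 (X : K). Proof. exact: (proj2 (p_typed H)). Qed.
Lemma src_tz : src (tz X) = id1 (X : K). Proof. exact: (proj1 (z_typed H)). Qed.
Lemma tgt_tz : tgt (tz X) = tT X. Proof. exact: (proj2 (z_typed H)). Qed.
Lemma src_ts : src (ts X) = tTn X 1. Proof. exact: (proj1 (s_typed H)). Qed.
Lemma tgt_ts : tgt (ts X) = tT X. Proof. exact: (proj2 (s_typed H)). Qed.
Lemma src_tl : src (tl X) = tT X. Proof. exact: (proj1 (l_typed H)). Qed.
Lemma tgt_tl : tgt (tl X) = tT X * tT X.
Proof. exact: (proj2 (l_typed H)). Qed.
Lemma src_tc : src (tc X) = tT X * tT X.
Proof. exact: (proj1 (c_typed H)). Qed.
Lemma tgt_tc : tgt (tc X) = tT X * tT X.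
Proof. exact: (proj2 (c_typed H)). Qed.

Lemma Tn_pullback0 n : pointwise_nfold_pullback2 (tTn X n)
  (fun k : 'I_n.+1 => tpr X k) (tp X).
Proof.
move=> Y F; have /= := Tn_pullback H n 0 F; rewrite comp1l lw1.
by under eq_fun => k do rewrite lw1.
Qed.

Lemma Tn_pullback1 n : pointwise_nfold_pullback2 (tT X * tTn X n)
  (fun k : 'I_n.+1 => tT X <* tpr X k) (tT X <* tp X).
Proof. by move=> Y F; have /= := Tn_pullback H n 1 F; rewrite comp1r. Qed.

Lemma typed_tpr n (k : 'I_n.+1) : typed (tpr X k) (tTn X n) (tT X).
Proof.
have [/(_ k)] := Tn_pullback0 n (id1 (X : K)).
by rewrite !rw1 src_tp comp1r.
Qed.
Lemma src_tpr n (k : 'I_n.+1) : src (tpr X k) = tTn X n.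
Proof. exact: (proj1 (typed_tpr k)). Qed.
Lemma tgt_tpr n (k : 'I_n.+1) : tgt (tpr X k) = tT X.
Proof. exact: (proj2 (typed_tpr k)). Qed.
Lemma tp_tpr n (i j : 'I_n.+1) : tp X \o tpr X i = tp X \o tpr X j.
Proof.
by have [_ /(_ i j)] := Tn_pullback0 n (id1 (X : K)); rewrite !rw1.
Qed.

End TangentadTheory.

Definition endsE := (src_lw, tgt_lw, src_rw, tgt_rw, src_id2, tgt_id2).
Definition tan_endsE := (src_tp, tgt_tp, src_tz, tgt_tz, src_ts, tgt_ts,
  src_tl, tgt_tl, src_tc, tgt_tc, src_tpr, tgt_tpr).

Lemma src_lcell (K : twoCat) (X Y : tangentad K) (F : lax X Y) :
  src (lcell F) = F * tT X.
Proof. exact: (proj1 (lax_typed (laxP F))). Qed.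

Lemma tgt_lcell (K : twoCat) (X Y : tangentad K) (F : lax X Y) :
  tgt (lcell F) = tT Y * F.
Proof. exact: (proj2 (lax_typed (laxP F))). Qed.

Ltac ends1 := idtac; first
  [ progress rewrite ?endsE ?tan_endsE ?src_lcell ?tgt_lcell
  | match goal with
    | H : typed ?a _ _ |- context [src ?a] => rewrite (proj1 H)
    | H : typed ?a _ _ |- context [tgt ?a] => rewrite (proj2 H)
    end
  | rewrite src_vcomp; [ | solve [repeat ends1; rewrite ?comp1l ?comp1r ?comp1A //] ]
  | rewrite tgt_vcomp; [ | solve [repeat ends1; rewrite ?comp1l ?comp1r ?comp1A //] ] ].
Ltac ends := repeat ends1; rewrite ?comp1l ?comp1r ?comp1A //.

Ltac nf := repeat first
  [ rewrite lw_vcomp; [ | solve [ends]]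
  | rewrite rw_vcomp; [ | solve [ends]]
  | rewrite -vcompA; [ | solve [ends] | solve [ends]] ];
  rewrite ?lw_lw ?rw_rw ?lw_rw ?lw_id2 ?rw_id2 ?lw1 ?rw1.


Lemma tail2 (K : twoCat) (X Y : K) (x y z t : cell X Y) :
  x \o y = z -> tgt t = src y -> tgt y = src x -> x \o (y \o t) = z \o t.
Proof. by move=> <- e1 e2; rewrite vcompA. Qed.

Lemma lax_pair (K : twoCat) (X Y : tangentad K) (F : lax X Y) :
  let h := pair2 (tpi1 Y *> F) (tpi2 Y *> F)
             (lcell F \o F <* tpi1 X) (lcell F \o F <* tpi2 X) in
  [/\ typed h (F * tTn X 1) (tTn Y 1 * F),
     tpi1 Y *> F \o h = lcell F \o F <* tpi1 X
   & tpi2 Y *> F \o h = lcell F \o F <* tpi2 X].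
Proof.
have tf (k : 'I_2) : typed (lcell F \o F <* tpr X k) (F * tTn X 1)
    (src (tp Y *> F)) by split; ends.
have ef : tp Y *> F \o (lcell F \o F <* tpi1 X) =
          tp Y *> F \o (lcell F \o F <* tpi2 X).
  rewrite !(tail2 (lax_p (laxP F))); try by ends.
  by rewrite /tpi1 /tpi2 -!lw_vcomp; [rewrite (tp_tpr _ (@Ordinal 2 0 isT) (@Ordinal 2 1 isT)) | ends | ends].
by have [] := pair2P (Tn_pullback0 1 F) (tf _) (tf _) ef.
Qed.

Section LaxComp.
Variables (K : twoCat) (X Y Z : tangentad K).
Variables (G : lax Y Z) (F : lax X Y).

Definition lax_comp_cell : cell X Z := lcell G *> F \o G <* lcell F.

Lemma lax_comp_p : tp Z *> (G * F) \o lax_comp_cell = (G * F) <* tp X.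
Proof.
rewrite /lax_comp_cell vcompA; [|ends|ends].
rewrite -rw_rw -rw_vcomp; last by ends.
rewrite (lax_p (laxP G)) -lw_rw -lw_vcomp; last by ends.
by rewrite (lax_p (laxP F)) lw_lw.
Qed.

Lemma lax_comp_z : lax_comp_cell \o (G * F) <* tz X = tz Z *> (G * F).
Proof.
rewrite /lax_comp_cell -vcompA; [|ends|ends].
rewrite -lw_lw -lw_vcomp; last by ends.
rewrite (lax_z (laxP F)) lw_rw -rw_vcomp; last by ends.
by rewrite (lax_z (laxP G)) rw_rw.
Qed.

Lemma lax_comp_s : lax_comp_cell \o (G * F) <* ts X =
  ts Z *> (G * F) \o pair2 (tpi1 Z *> (G * F)) (tpi2 Z *> (G * F))
    (lax_comp_cell \o (G * F) <* tpi1 X) (lax_comp_cell \o (G * F) <* tpi2 X).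
Proof.
have [] := lax_pair F; have [] := lax_pair G.
have := lax_s (laxP F); have := lax_s (laxP G).
set k := pair2 _ _ _ _; set h := pair2 _ _ _ _.
move=> sG sF tk k1 k2 th h1 h2.
have proj (i : 'I_2) : tpr Z i *> G \o k = lcell G \o G <* tpr Y i ->
    tpr Y i *> F \o h = lcell F \o F <* tpr X i ->
    tpr Z i *> (G * F) \o (k *> F \o G <* h) =
    lax_comp_cell \o (G * F) <* tpr X i.
  move=> ki hi; rewrite /lax_comp_cell vcompA; [|ends|ends].
  rewrite -rw_rw -rw_vcomp; last by ends.
  rewrite ki rw_vcomp; last by ends.
  rewrite -vcompA; [|ends|ends].
  rewrite -lw_rw -lw_vcomp; last by ends.
  by rewrite hi; nf.
have tf (i : 'I_2) : typed (lax_comp_cell \o (G * F) <* tpr X i)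
    (G * F * tTn X 1) (src (tp Z *> (G * F))).
  by rewrite /lax_comp_cell; split; ends.
have ef : tp Z *> (G * F) \o (lax_comp_cell \o (G * F) <* tpi1 X) =
          tp Z *> (G * F) \o (lax_comp_cell \o (G * F) <* tpi2 X).
  rewrite !(tail2 lax_comp_p); try by rewrite /lax_comp_cell; ends.
  rewrite -!lw_vcomp; try by ends.
  by rewrite /tpi1 /tpi2 (tp_tpr _ (@Ordinal 2 0 isT) (@Ordinal 2 1 isT)).
have [tm _ _ um] := pair2P (Tn_pullback0 1 (G * F)) (tf _) (tf _) ef.
rewrite -(um (k *> F \o G <* h)); first last.
- exact: proj.
- exact: proj.
- by split; ends.
rewrite /lax_comp_cell vcompA; [|ends|ends].
rewrite -rw_rw -rw_vcomp; last by ends.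
rewrite -sG rw_vcomp; last by ends.
rewrite -lw_rw -!vcompA; try by ends.
rewrite -[in RHS]lw_vcomp; last by ends.
rewrite -sF; by nf.
Qed.

Lemma lax_comp_exchange :
  lcell G *> (tT Y * F) \o (G * tT Y) <* lcell F =
  (tT Z * G) <* lcell F \o lcell G *> (F * tT X).
Proof. by apply: whisk_exchange; [exact: lax_typed (laxP F) | exact: lax_typed (laxP G)]. Qed.

Lemma lax_comp_double :
  tT Z <* lax_comp_cell \o lax_comp_cell *> tT X =
  (tT Z <* lcell G \o lcell G *> tT Y) *> F \o
  G <* (tT Y <* lcell F \o lcell F *> tT X).
Proof.
rewrite /lax_comp_cell; nf.
rewrite (tail2 (esym lax_comp_exchange)); try by ends.
by nf.
Qed.

Lemma lax_comp_l : tl Z *> (G * F) \o lax_comp_cell =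
  tT Z <* lax_comp_cell \o lax_comp_cell *> tT X \o (G * F) <* tl X.
Proof.
rewrite lax_comp_double -[_ \o _ <* tl X]vcompA; [|ends|ends].
rewrite -lw_lw -lw_vcomp; last by ends.
rewrite -(lax_l (laxP F)) lw_vcomp; last by ends.
rewrite lw_rw vcompA; [|ends|ends].
rewrite -rw_vcomp; last by ends.
rewrite -(lax_l (laxP G)) /lax_comp_cell; by nf.
Qed.

Lemma lax_comp_c :
  tc Z *> (G * F) \o tT Z <* lax_comp_cell \o lax_comp_cell *> tT X =
  tT Z <* lax_comp_cell \o lax_comp_cell *> tT X \o (G * F) <* tc X.
Proof.
rewrite -[LHS]vcompA; try by rewrite /lax_comp_cell; ends.
rewrite lax_comp_double -[in RHS]vcompA; [|ends|ends].
rewrite -lw_lw -lw_vcomp; last by ends.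
rewrite -(lax_c (laxP F)) -[in RHS]vcompA; [|ends|ends].
rewrite [in RHS]lw_vcomp; last by ends.
rewrite [in RHS]vcompA; [|ends|ends].
rewrite [in RHS]lw_rw -[in RHS]rw_vcomp; last by ends.
rewrite -(lax_c (laxP G)); by nf.
Qed.

Lemma lax_compP : isLax (G * F) lax_comp_cell.
Proof.
split; [by rewrite /lax_comp_cell; split; ends | exact: lax_comp_p
 | exact: lax_comp_z | exact: lax_comp_s | exact: lax_comp_l | exact: lax_comp_c].
Qed.

Definition lax_comp : lax X Z := Lax lax_compP.

End LaxComp.

Lemma lax_eq (K : twoCat) (X Y : tangentad K) (F G : lax X Y) :
  lmor F = lmor G -> lcell F = lcell G -> F = G.
Proof.
case: F G => [F a aP] [G b bP] /= eFG eab; subst G b.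
by rewrite (Prop_irrelevance aP bP).
Qed.

Lemma strict_eq (K : twoCat) (X Y : tangentad K) (F G : strict X Y) :
  lmor F = lmor G -> F = G.
Proof.
case: F G => [F sF] [G sG] /= e.
have eFG : F = G by apply: lax_eq => //; rewrite sF sG e.
by subst G; rewrite (Prop_irrelevance sF sG).
Qed.

Lemma lax_idP (K : twoCat) (X : tangentad K) :
  isLax (id1 (X : K)) (id2 (tT X)) (X := X) (Y := X).
Proof.
have tid : typed (id2 (tT X)) (id1 (X : K) * tT X) (tT X * id1 (X : K)).
  by split; ends.
have tH (a : cell X X) F : typed a F (tT X) -> id2 (tT X) \o a = a.
  exact: vcomp_idl.
split; rewrite ?lw1 ?rw1 //.
- by rewrite (vcomp_idr (p_typed (tangentP (tstruct X)))).
- by rewrite (tH _ _ (z_typed (tangentP (tstruct X)))).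
- rewrite !(tH _ _ (s_typed (tangentP (tstruct X)))) !(tH _ _ (typed_tpr _ _)).
  have := pair2P (Tn_pullback0 1 (id1 (X : K))); rewrite !rw1.
  move=> /(_ _ (tpi1 X) (tpi2 X)) -/(_ (tTn X 1)) P.
  have t1 (k : 'I_2) : typed (tpr X k) (tTn X 1) (src (tp X)).
    by split; ends.
  have [_ _ _ /(_ (id2 (tTn X 1)))] :=
    P (t1 _) (t1 _) (tp_tpr X (@Ordinal 2 0 isT) (@Ordinal 2 1 isT)).
  rewrite comp1r => <-; first by rewrite (vcomp_idr (s_typed (tangentP (tstruct X)))).
  + exact: typed_id2.
  + exact: vcomp_idr (typed_tpr _ _).
  + exact: vcomp_idr (typed_tpr _ _).
- rewrite lw_id2 rw_id2 vcomp_id2.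
  by rewrite (vcomp_idr (l_typed (tangentP (tstruct X))))
    (vcomp_idl (l_typed (tangentP (tstruct X)))).
- rewrite lw_id2 rw_id2 -vcompA ?vcomp_id2; try by ends.
  by rewrite (vcomp_idr (c_typed (tangentP (tstruct X))))
    (vcomp_idl (c_typed (tangentP (tstruct X)))).
Qed.

Definition lax_id (K : twoCat) (X : tangentad K) : lax X X := Lax (lax_idP X).

Lemma lax_TP (K : twoCat) (X : tangentad K) :
  isLax (tT X) (tc X) (X := X) (Y := X).
Proof.
have D := tangentP (tstruct X).
split; [exact: c_typed D | exact: pT_c D | exact: c_Tz D | exact: c_Ts D | |
  exact: esym (Tc_c_Tc D)].
have e : tT X <* tl X = (tT X <* tl X \o tc X) \o tc X.
  rewrite -vcompA; [|ends|ends].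
  rewrite (c_c D) (vcomp_idr (F := tT X * tT X) (G := tT X * (tT X * tT X))) //.
  by split; ends.
rewrite e -(c_Tc_l D) -[dc _]/(tc X) -[dT _]/(tT X) -[dl _]/(tl X).
rewrite -!vcompA; try by ends.
have ec : tc X *> tT X \o tc X *> tT X = id2 (tT X * tT X * tT X).
  by rewrite -rw_vcomp; [rewrite (c_c D) rw_id2 | ends].
have ed : tT X <* tc X \o tT X <* tc X = id2 (tT X * tT X * tT X).
  by rewrite -lw_vcomp; [rewrite (c_c D) lw_id2 comp1A | ends].
rewrite (tail2 ec); try by ends.
rewrite (vcomp_idl (F := tT X * tT X)); last by split; ends.
rewrite (tail2 ed); try by ends.
by rewrite (vcomp_idl (F := tT X * tT X)) //; split; ends.
Qed.

Definition lax_T (K : twoCat) (X : tangentad K) : lax X X := Lax (lax_TP X).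

Section LaxLaws.
Variable K : twoCat.

Lemma lax_compA (X Y Z W : tangentad K)
    (H : lax Z W) (G : lax Y Z) (F : lax X Y) :
  lax_comp H (lax_comp G F) = lax_comp (lax_comp H G) F.
Proof.
apply: lax_eq => /=; first exact: comp1A.
by rewrite /lax_comp_cell /=; nf.
Qed.

Lemma lax_compl (X Y : tangentad K) (F : lax X Y) : lax_comp (lax_id Y) F = F.
Proof.
apply: lax_eq => /=; first exact: comp1l.
rewrite /lax_comp_cell /= rw_id2 lw1.
exact: vcomp_idl (lax_typed (laxP F)).
Qed.

Lemma lax_compr (X Y : tangentad K) (F : lax X Y) : lax_comp F (lax_id X) = F.
Proof.
apply: lax_eq => /=; first exact: comp1r.
rewrite /lax_comp_cell /= lw_id2 rw1.
exact: vcomp_idr (lax_typed (laxP F)).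
Qed.

Lemma strict_compP (X Y Z : tangentad K) (G : strict Y Z) (F : strict X Y) :
  is_strict (lax_comp G F).
Proof.
have tF := lax_typed (laxP F); have tG := lax_typed (laxP G).
rewrite /is_strict /= /lax_comp_cell.
have eG : tT Z * G = G * tT Y.
  by rewrite -(proj2 tG) strictP tgt_id2.
have eF : tT Y * F = F * tT X.
  by rewrite -(proj2 tF) strictP tgt_id2.
by rewrite !strictP lw_id2 rw_id2 -comp1A eF comp1A vcomp_id2.
Qed.

Definition strict_comp (X Y Z : tangentad K) (G : strict Y Z) (F : strict X Y) :
  strict X Z := Strict (strict_compP G F).

Lemma strict_idP (X : tangentad K) : is_strict (lax_id X).
Proof. by rewrite /is_strict /= comp1l. Qed.

Definition strict_id (X : tangentad K) : strict X X := Strict (strict_idP X).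

Lemma tangent2_id (X Y : tangentad K) (F : lax X Y) : is_tangent2 F F (id2 F).
Proof.
split; first exact: typed_id2.
by rewrite lw_id2 rw_id2 (vcomp_idl (lax_typed (laxP F)))
  (vcomp_idr (lax_typed (laxP F))).
Qed.

Lemma tangent2_comp (X Y : tangentad K) (F G H : lax X Y) (b a : cell X Y) :
  is_tangent2 G H b -> is_tangent2 F G a -> is_tangent2 F H (b \o a).
Proof.
move=> [tb eb] [ta ea]; split; first exact: typed_comp tb ta.
rewrite lw_vcomp; last by ends.
rewrite -vcompA; [|ends|ends].
rewrite ea vcompA; [|ends|ends].
rewrite eb rw_vcomp; last by ends.
by rewrite -[in LHS]vcompA //; ends.
Qed.

Lemma tangent2_lw (X Y Z : tangentad K) (H : lax Y Z) (F G : lax X Y)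
    (a : cell X Y) :
  is_tangent2 F G a -> is_tangent2 (lax_comp H F) (lax_comp H G) (H <* a).
Proof.
move=> [ta ea]; split; first exact: typed_lw.
rewrite /= /lax_comp_cell lw_lw.
have := whisk_exchange ta (lax_typed (laxP H)) => e.
rewrite (tail2 (esym e)); try by ends.
rewrite -[LHS]vcompA; [|ends|ends].
rewrite -lw_lw -lw_vcomp; last by ends.
by rewrite ea; nf.
Qed.

Lemma tangent2_rw (X Y Z : tangentad K) (H : lax X Y) (F G : lax Y Z)
    (a : cell Y Z) :
  is_tangent2 F G a -> is_tangent2 (lax_comp F H) (lax_comp G H) (a *> H).
Proof.
move=> [ta ea]; split; first exact: typed_rw.
rewrite /= /lax_comp_cell lw_rw vcompA; [|ends|ends].
rewrite -rw_vcomp; last by ends.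
rewrite ea rw_vcomp; last by ends.
rewrite -[LHS]vcompA; [|ends|ends].
have := whisk_exchange (lax_typed (laxP H)) ta => e.
by rewrite rw_rw e; nf.
Qed.

Lemma tangent2_tp (X : tangentad K) : is_tangent2 (lax_T X) (lax_id X) (tp X).
Proof.
have D := tangentP (tstruct X).
split; first exact: p_typed D.
rewrite /= -(pT_c D) -[dc _]/(tc X) -[dT _]/(tT X) -[dp _]/(tp X).
rewrite -vcompA; [|ends|ends].
rewrite (c_c D) (vcomp_idr (F := tT X * tT X) (G := tT X)); last by split; ends.
by rewrite (vcomp_idl (F := tT X * tT X)) //; split; ends.
Qed.

Lemma tangent2_tz (X : tangentad K) : is_tangent2 (lax_id X) (lax_T X) (tz X).
Proof.
have D := tangentP (tstruct X).
split; first exact: z_typed D.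
rewrite /= -(c_Tz D) -[dc _]/(tc X) -[dT _]/(tT X) -[dz _]/(tz X).
rewrite vcompA; [|ends|ends].
rewrite (c_c D) (vcomp_idr (F := tT X) (G := tT X * tT X)); last by split; ends.
by rewrite (vcomp_idl (F := tT X)) //; split; ends.
Qed.

End LaxLaws.

Local Obligation Tactic := idtac.

Record category := Category {
  cob :> Type;
  chom : cob -> cob -> Type;
  cid : forall A, chom A A;
  ccomp : forall A B C, chom B C -> chom A B -> chom A C;
  ccompA : forall A B C D (h : chom C D) (g : chom B C) (f : chom A B),
    ccomp h (ccomp g f) = ccomp (ccomp h g) f;
  ccompl : forall A B (f : chom A B), ccomp (cid B) f = f;
  ccompr : forall A B (f : chom A B), ccomp f (cid A) = f
}.

Arguments cid {c}.

Reserved Notation "g \c f" (at level 50, left associativity).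
Declare Scope cat_scope.
Delimit Scope cat_scope with cat.
Notation "g \c f" := (ccomp g f) : cat_scope.
Local Open Scope cat_scope.

Record functor (C D : category) := Functor {
  fob :> C -> D;
  fmap : forall A B, chom A B -> chom (fob A) (fob B);
  fmap_id : forall A, fmap (cid A) = cid (fob A);
  fmap_comp : forall A B E (g : chom B E) (f : chom A B),
    fmap (g \c f) = fmap g \c fmap f
}.

Program Definition functor_id (C : category) : functor C C :=
  @Functor C C id (fun A B f => f) _ _.
Next Obligation. by []. Qed.
Next Obligation. by []. Qed.

Program Definition functor_comp (C D E : category)
    (G : functor D E) (F : functor C D) : functor C E :=
  @Functor C E (fun A => G (F A)) (fun A B f => fmap G (fmap F f)) _ _.
Next Obligation. by move=> C D E G F A /=; rewrite !fmap_id. Qed.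
Next Obligation. by move=> C D E G F A B L g f /=; rewrite !fmap_comp. Qed.

Definition invertible (C D : category) (F : functor C D) : Prop :=
  exists G : functor D C,
    functor_comp G F = functor_id C /\ functor_comp F G = functor_id D.

Definition is_nfold_pullback (C : category) (E B P : C) (n : nat)
    (pi : 'I_n.+1 -> chom P E) (q : chom E B) : Prop :=
  (forall i j, q \c pi i = q \c pi j) /\
  forall (Z : C) (f : 'I_n.+1 -> chom Z E),
    (forall i j, q \c f i = q \c f j) ->
    exists! h : chom Z P, forall k, pi k \c h = f k.

(* h = <f, g> *)
Definition is_pair (C : category) (E P Z : C) (pi : 'I_2 -> chom P E)
    (f g : chom Z E) (h : chom Z P) : Prop :=
  pi (@Ordinal 2 0 isT) \c h = f /\ pi (@Ordinal 2 1 isT) \c h = g.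

(* The pairings are determined by the first field, so the existential quantifiers
   only name them. *)
Record isAdditiveBundle (C : category) (E B : C) (q : chom E B)
    (En : nat -> C) (pi : forall n, 'I_n.+1 -> chom (En n) E)
    (zq : chom B E) (sq : chom (En 1) E) : Prop := IsAdditiveBundle {
  ab_pullback : forall n, is_nfold_pullback (pi n) q;
  ab_qz : q \c zq = cid B;
  ab_qs : q \c sq = q \c pi 1 (@Ordinal 2 0 isT);
  ab_assoc :
    let rho1 := pi 2 (@Ordinal 3 0 isT) in
    let rho2 := pi 2 (@Ordinal 3 1 isT) in
    let rho3 := pi 2 (@Ordinal 3 2 isT) in
    exists a b h h' : chom (En 2) (En 1),
      [/\ is_pair (pi 1) rho1 rho2 a, is_pair (pi 1) (sq \c a) rho3 h,
          is_pair (pi 1) rho2 rho3 b, is_pair (pi 1) rho1 (sq \c b) h'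
        & sq \c h = sq \c h'];
  ab_comm : exists2 h : chom (En 1) (En 1),
    is_pair (pi 1) (pi 1 (@Ordinal 2 1 isT)) (pi 1 (@Ordinal 2 0 isT)) h
    & sq \c h = sq;
  ab_unit : exists2 h : chom E (En 1),
    is_pair (pi 1) (zq \c q) (cid E) h & sq \c h = cid E
}.

Lemma sval_eq (A : Type) (P : A -> Prop) (x y : {a | P a}) :
  sval x = sval y -> x = y.
Proof. by case: x y => [a Pa] [b Pb] /= e; exact: eq_exist. Qed.

Section VectorFields.
Variables (C : category) (T : functor C C) (p : forall M : C, chom (T M) M).

Record vectorField (M : C) := VectorField {
  vf :> chom M (T M);
  vfP : p M \c vf = cid M
}.

Record vfObj := VfObj { vbase : C; vfield : vectorField vbase }.

Definition vfHom (A B : vfObj) : Type :=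
  {f : chom (vbase A) (vbase B) | fmap T f \c vfield A = vfield B \c f}.

Program Definition vfId (A : vfObj) : vfHom A A := cid (vbase A).
Next Obligation. by move=> A /=; rewrite fmap_id ccompl ccompr. Qed.

Program Definition vfComp (A B D : vfObj) (g : vfHom B D) (f : vfHom A B) :
  vfHom A D := sval g \c sval f.
Next Obligation.
move=> A B D [g eg] [f ef] /=.
by rewrite fmap_comp -ccompA ef ccompA eg ccompA.
Qed.

Program Definition vfCat : category := @Category vfObj vfHom vfId vfComp _ _ _.
Next Obligation. by move=> *; apply: sval_eq; rewrite /= ccompA. Qed.
Next Obligation. by move=> *; apply: sval_eq; rewrite /= ccompl. Qed.
Next Obligation. by move=> *; apply: sval_eq; rewrite /= ccompr. Qed.

End VectorFields.

Section HomTangent.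
Variables (K : twoCat) (X Y : tangentad K).

Definition homTngHom (F G : lax X Y) : Type :=
  {a : cell X Y | is_tangent2 F G a}.

Definition homTngComp (F G H : lax X Y) (b : homTngHom G H)
    (a : homTngHom F G) : homTngHom F H :=
  exist _ (sval b \o sval a) (tangent2_comp (svalP b) (svalP a)).

Program Definition homTng : category :=
  @Category (lax X Y) homTngHom (fun F => exist _ (id2 F) (tangent2_id F))
    homTngComp _ _ _.
Next Obligation.
move=> F G H L [c [tc ec]] [b [tb eb]] [a [ta ea]]; apply: sval_eq => /=.
exact: vA ta tb tc.
Qed.
Next Obligation.
by move=> F G [a [ta ea]]; apply: sval_eq; exact: vcomp_idl ta.
Qed.
Next Obligation.
by move=> F G [a [ta ea]]; apply: sval_eq; exact: vcomp_idr ta.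
Qed.

Program Definition Tbar : functor homTng homTng :=
  @Functor homTng homTng (fun F : lax X Y => lax_comp (lax_T Y) F)
    (fun F G a => exist _ (tT Y <* sval a) (tangent2_lw (lax_T Y) (svalP a)))
    _ _.
Next Obligation. by move=> F; apply: sval_eq; exact: lw_id2. Qed.
Next Obligation.
move=> F G H [b [tb eb]] [a [ta ea]]; apply: sval_eq => /=; exact: lwv ta tb.
Qed.

Lemma pbar_subproof (F : lax X Y) :
  is_tangent2 (lax_comp (lax_T Y) F) F (tp Y *> F).
Proof.
by have := tangent2_rw F (tangent2_tp Y); rewrite lax_compl.
Qed.

Definition pbar (F : homTng) : chom (Tbar F) F := exist _ _ (pbar_subproof F).

Definition vfHomTng : category := vfCat pbar.

Definition vfcell (A : vfHomTng) : cell X Y := sval (vf (vfield A)).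

(* W = A + B, for vector fields A and B on the same tangent morphism *)
Definition is_vf_sum (A B W : vfHomTng) : Prop :=
  let F : lax X Y := vbase A in
  [/\ vbase B = vbase A, vbase W = vbase A
    & vfcell W = ts Y *> F \o
        pair2 (tpi1 Y *> F) (tpi2 Y *> F) (vfcell A) (vfcell B)].

End HomTangent.

(* The underlying category of the 2-category of tangentads, strict tangent
   morphisms and tangent 2-morphisms. *)
Program Definition TngS (K : twoCat) : category :=
  @Category (tangentad K) (@strict K) (@strict_id K) (@strict_comp K) _ _ _.
Next Obligation. by move=> *; apply: strict_eq; exact: comp1A. Qed.
Next Obligation. by move=> *; apply: strict_eq; exact: comp1l. Qed.
Next Obligation. by move=> *; apply: strict_eq; exact: comp1r. Qed.

(* n-fold 2-pullbacks in the 2-category of tangentads, lax tangent morphisms and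
   tangent 2-morphisms *)
Definition is_nfold_2pullback_Tng (K : twoCat) (E B P : tangentad K) (n : nat)
    (pi : 'I_n.+1 -> lax P E) (U : lax E B) : Prop :=
  [/\ forall i j, lax_comp U (pi i) = lax_comp U (pi j),
      forall (Z : tangentad K) (F : 'I_n.+1 -> lax Z E),
        (forall i j, lax_comp U (F i) = lax_comp U (F j)) ->
        exists! H : lax Z P, forall k, lax_comp (pi k) H = F k
    & forall (Z : tangentad K) (F G : lax Z P) (a : 'I_n.+1 -> cell Z E),
        (forall k, is_tangent2 (lax_comp (pi k) F) (lax_comp (pi k) G) (a k)) ->
        (forall i j, U <* a i = U <* a j) ->
        exists! b : cell Z P, is_tangent2 F G b /\ forall k, pi k <* b = a k].

Section Gamma.
Variables (K : twoCat) (V X : tangentad K) (U : strict V X).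
Variables (v : vectorField (@pbar K V X) (U : lax V X)) (X' : tangentad K).

Let vc : cell V X := sval (vf v).

Lemma Gamma_field_subproof (H : lax X' V) :
  is_tangent2 (lax_comp U H) (lax_comp (lax_T X) (lax_comp U H)) (vc *> H).
Proof. by rewrite lax_compA; apply: tangent2_rw; exact: (svalP (vf v)). Qed.

Definition Gamma_field (H : lax X' V) :
    chom (lax_comp U H : homTng X' X) (Tbar X' X (lax_comp U H)) :=
  exist _ (vc *> H) (Gamma_field_subproof H).

Lemma Gamma_vfP (H : lax X' V) :
  pbar (lax_comp U H) \c Gamma_field H = cid (lax_comp U H : homTng X' X).
Proof.
apply: sval_eq => /=.
have /(congr1 sval) /= e := vfP v.
have [tv _] := svalP (vf v); rewrite -/vc in tv e.
rewrite -rw_rw -rw_vcomp; last by ends.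
by rewrite e rw_id2.
Qed.

Definition Gamma_ob (H : homTng X' V) : vfHomTng X' X :=
  @VfObj (homTng X' X) (Tbar X' X) (@pbar K X' X) (lax_comp U H)
    (VectorField (Gamma_vfP H)).

Lemma Gamma_mapP (H G : homTng X' V) (a : chom H G) :
  let Ua : chom (lax_comp U H : homTng X' X) (lax_comp U G) :=
    exist _ (U <* sval a) (tangent2_lw U (svalP a)) in
  fmap (Tbar X' X) Ua \c vfield (Gamma_ob H) = vfield (Gamma_ob G) \c Ua.
Proof.
apply: sval_eq => /=.
have [ta _] := svalP a; have [tv _] := svalP (vf v).
by rewrite (whisk_exchange ta tv) lw_lw.
Qed.

Program Definition Gamma : functor (homTng X' V) (vfHomTng X' X) :=
  @Functor (homTng X' V) (vfHomTng X' X) Gamma_ob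
    (fun H G a => exist _ _ (Gamma_mapP a)) _ _.
Next Obligation.
by move=> H; do 2 apply: sval_eq => /=; exact: lw_id2.
Qed.
Next Obligation.
move=> H G L [b [tb eb]] [a [ta ea]]; do 2 apply: sval_eq => /=.
exact: lwv ta tb.
Qed.

End Gamma.

Record vfConstruction (K : twoCat) (X : tangentad K) := VfConstruction {
  VF : tangentad K;
  VFU : strict VF X;
  VFv : vectorField (@pbar K VF X) (VFU : lax VF X);
  VF_universal : forall X' : tangentad K, invertible (Gamma VFv X')
}.

Section ZeroField.
Variables (K : twoCat) (X : tangentad K).

Lemma zero_field_subproof :
  is_tangent2 (lax_id X) (lax_comp (lax_T X) (lax_id X)) (tz X).
Proof. by rewrite lax_compr; exact: tangent2_tz. Qed.

Definition zero_field :
    chom (lax_id X : homTng X X) (Tbar X X (lax_id X)) :=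
  exist _ (tz X) zero_field_subproof.

Lemma zero_fieldP :
  pbar (lax_id X) \c zero_field = cid (lax_id X : homTng X X).
Proof.
by apply: sval_eq; rewrite /= rw1; exact: (pz (tangentP (tstruct X))).
Qed.

Definition vf_zero : vfHomTng X X :=
  @VfObj (homTng X X) (Tbar X X) (@pbar K X X) (lax_id X)
    (VectorField zero_fieldP).

End ZeroField.

(* Main.v *)
Require Import Defs.
From mathcomp Require Import all_boot.
From mathcomp Require Import boolp.

Set Implicit Arguments.
Unset Strict Implicit.
Unset Printing Implicit Defensive.

Local Open Scope twocat_scope.

(** The theorem has two halves.

    The additive bundle itself is formal.  By the universal property, a tangent
    morphism H into the tangentad V of vector fields is determined by the
    tangent morphism U H and the vector field v_H on it ([VF_mor_inj]), and a
    composite of the sum morphism with <f, g> corresponds to the vector field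
    v_f + v_g ([add_pair]).  So associativity, commutativity and the unit law
    for the sum of vector fields, which come from those of s, become the same
    laws for the morphisms ([additive_bundle]).  The zero and sum morphisms are
    strict because strictness is reflected along U: if U H is strict, then the
    structure cell of H is a 2-morphism between tangent morphisms into V which
    becomes an identity in the base, and the universal property makes it an
    identity ([VF_strict_reflect]).

    The work is in the tangent structure of the 2-pullbacks P = VF_n.  The
    2-morphisms into P are the families of 2-morphisms into V that agree after U,
    so one would like to define everything componentwise.  This needs
    U T_n = T_n U on the nose, but a strict tangent morphism only commutes with
    T: its canonical comparison from U T_n to T_n U need not even be
    invertible.  For the tangentad of vector fields it is.  The pullback T_n is
    itself a tangent endomorphism of every tangentad ([lax_Tn]), and T_n U
    carries a vector field obtained by applying T v and c on each factor
    ([Tn_field_exists]).  The universal property turns it into an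
    endomorphism H_n of V with U H_n = T_n U, and comparing the two as pullbacks of
    tangent morphisms shows that H_n is isomorphic to T_n over the
    projections ([VF_Tn_iso]).  Hence one may replace the chosen pullbacks
    T_n of V by the H_n without changing T, p, z, l, c ([changedP]); with this
    new choice U preserves the whole structure strictly, and the structure on P
    is componentwise ([twopb_data], [twopb_tangent]).  Each axiom holds because
    the projections of P are jointly faithful, and each universal property
    because pullbacks in a pullback of categories are computed on the factors,
    as soon as the functor to the base preserves them ([twopb_nfold],
    [twopb_square]).  The same joint faithfulness shows that P is also the
    2-pullback among tangentads ([strict_2pullback]). *)

(** * Tactics and pullbacks of 2-morphisms *)

Notation o20 := (@Ordinal 2 0 isT).
Notation o21 := (@Ordinal 2 1 isT).
Notation o30 := (@Ordinal 3 0 isT).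
Notation o31 := (@Ordinal 3 1 isT).
Notation o32 := (@Ordinal 3 2 isT).

Ltac whisk := rewrite ?(lw_rw, lw_lw, rw_rw, lw_id2, rw_id2, lw1, rw1).
Ltac push := repeat first
  [ rewrite lw_vcomp; [ | solve [ends]]
  | rewrite rw_vcomp; [ | solve [ends]] ]; whisk.
Ltac assocr := repeat (rewrite -vcompA; [ | solve [ends] | solve [ends]]).
Ltac assocl := repeat (rewrite vcompA; [ | solve [ends] | solve [ends]]).
Ltac norm := push; assocr.
Ltac typ := solve [split; ends].
(* rewrites x \o (y \o t) with e : x \o y = z *)
Ltac tail e := rewrite (tail2 e); [ | solve [ends] | solve [ends]].

Section PullbackCalculus.
Variables (K : twoCat) (X Y : K) (n : nat) (P : mor X Y).
Variables (pi : 'I_n.+1 -> cell X Y) (q : cell X Y).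
Hypothesis HP : is_nfold_pullback2 P pi q.

Lemma nfold_typed k : typed (pi k) P (src q).
Proof. by case: HP. Qed.

Lemma nfold_inj (G : mor X Y) (h h' : cell X Y) :
  typed h G P -> typed h' G P -> (forall k, pi k \o h = pi k \o h') -> h = h'.
Proof.
case: HP => tpi epi univ th th' e.
have [||h0 [_ uh0]] := univ G (fun k => pi k \o h).
- by move=> k; have tk := tpi k; typ.
- move=> i j; have ti := tpi i; have tj := tpi j.
  by rewrite !vcompA; [rewrite (epi i j) | ends..].
have -> : h' = h0 by apply/esym/uh0; split=> // k; rewrite e.
by apply/esym/uh0.
Qed.

Lemma nfold_lift (G : mor X Y) (f : 'I_n.+1 -> cell X Y) :
  (forall k, typed (f k) G (src q)) -> (forall i j, q \o f i = q \o f j) ->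
  exists2 h, typed h G P & forall k, pi k \o h = f k.
Proof.
case: HP => tpi epi univ tf ef.
by have [h [[th eh] _]] := univ G f tf ef; exists h.
Qed.

(** Pullbacks transport along an isomorphism of their vertex; it is given by its
    two inverse 2-morphisms because composition is meaningful only on composable
    pairs. *)
Lemma nfold_iso (P' : mor X Y) (k k' : cell X Y) :
  typed k P' P -> typed k' P P' -> k \o k' = id2 P -> k' \o k = id2 P' ->
  is_nfold_pullback2 P' (fun i => pi i \o k) q.
Proof.
case: (HP) => tpi epi univ tk tk' kk' k'k; split.
- by move=> i; have ti := tpi i; typ.
- move=> i j; have ti := tpi i; have tj := tpi j.
  by rewrite !vcompA; [rewrite (epi i j) | ends..].
- move=> G f tf ef; have [h [[th eh] uh]] := univ G f tf ef.
  exists (k' \o h); split=> [|h' [th' eh']].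
    split=> [|i]; first by typ.
    have ti := tpi i; assocr; tail kk'.
    by rewrite (vcomp_idl th) eh.
  rewrite (uh (k \o h')); first by tail k'k; rewrite (vcomp_idl th').
  split=> [|i]; first by typ.
  by have ti := tpi i; rewrite -eh'; assocl.
Qed.

End PullbackCalculus.

Lemma pointwise_id (K : twoCat) (X Y : K) n (P : mor X Y)
    (pi : 'I_n.+1 -> cell X Y) (q : cell X Y) :
  pointwise_nfold_pullback2 P pi q -> is_nfold_pullback2 P pi q.
Proof.
move=> /(_ _ (id1 X)); rewrite comp1r rw1.
by under eq_fun => i do rewrite rw1.
Qed.

Lemma pullback_iso (K : twoCat) (X Y : K) (P P' : mor X Y)
    (a b f g k k' : cell X Y) :
  is_pullback2 P a b f g ->
  typed k P' P -> typed k' P P' -> k \o k' = id2 P -> k' \o k = id2 P' ->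
  is_pullback2 P' (a \o k) (b \o k) f g.
Proof.
case=> ta tb efg eab univ tk tk' kk' k'k; split=> //; [typ|typ| |].
- by rewrite !vcompA; [rewrite eab | ends..].
- move=> G x y tx ty exy; have [h [[th ea eb] uh]] := univ G x y tx ty exy.
  exists (k' \o h); split=> [|h' [th' ea' eb']].
    split; first by typ.
      by assocr; tail kk'; rewrite (vcomp_idl th).
    by assocr; tail kk'; rewrite (vcomp_idl th).
  rewrite (uh (k \o h')); first by tail k'k; rewrite (vcomp_idl th').
  by split; [typ | rewrite -ea'; assocl | rewrite -eb'; assocl].
Qed.

Lemma pullback_inj (K : twoCat) (X Y : K) (P G : mor X Y)
    (a b f g h h' : cell X Y) :
  is_pullback2 P a b f g -> typed h G P -> typed h' G P ->
  a \o h = a \o h' -> b \o h = b \o h' -> h = h'.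
Proof.
case=> ta tb efg eab univ th th' ea eb.
have [|||h0 [_ uh]] := univ G (a \o h) (b \o h); [typ|typ| |].
- by rewrite !vcompA; [rewrite eab | ends..].
by rewrite -(uh h) // -(uh h') //; split.
Qed.

Section Pair.
Variables (K : twoCat) (X Y : K) (P : mor X Y) (pi : 'I_2 -> cell X Y).
Variable (q : cell X Y).
Hypothesis HP : is_nfold_pullback2 P pi q.

(** Together with [pair_lift], this is how pairings are handled throughout: an
    arbitrary matching pair is replaced by the two projections of one h, and
    the unspecified values of [pair2] never occur. *)
Lemma pair_eta (G : mor X Y) (h : cell X Y) : typed h G P ->
  pair2 (pi o20) (pi o21) (pi o20 \o h) (pi o21 \o h) = h.
Proof.
move=> th; have t0 := nfold_typed HP o20; have t1 := nfold_typed HP o21.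
have [||| _ _ _ u] := pair2P HP (f := pi o20 \o h) (g := pi o21 \o h) (G := G);
  [typ|typ| |by rewrite -(u h)].
have e : q \o pi o20 = q \o pi o21 by case: HP.
by assocl; rewrite e.
Qed.

Lemma pair_lift (G : mor X Y) (f g : cell X Y) :
  typed f G (src q) -> typed g G (src q) -> q \o f = q \o g ->
  exists h, [/\ typed h G P, f = pi o20 \o h & g = pi o21 \o h].
Proof.
move=> tf tg e; have [th e0 e1 _] := pair2P HP tf tg e.
by exists (pair2 (pi o20) (pi o21) f g).
Qed.

End Pair.

Section PairChange.
Variables (K : twoCat) (X Y : K) (P : mor X Y) (pi : 'I_2 -> cell X Y).
Variable (q : cell X Y).
Hypothesis HP : is_nfold_pullback2 P pi q.

(** Independence of the choice of pullback: an operation s on P becomes s \o k on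
    an isomorphic choice P', and both give the same value on f and g.  The extra
    precomposition with k0 covers the axioms in which the arguments are
    themselves taken from the new choice. *)
Lemma pair_change (P' G G' Z : mor X Y) (k k0 s f g : cell X Y) :
  typed k P' P -> is_nfold_pullback2 P' (fun i => pi i \o k) q ->
  typed f G (src q) -> typed g G (src q) -> q \o f = q \o g ->
  typed k0 G' G -> typed s P Z ->
  s \o k \o pair2 (pi o20 \o k) (pi o21 \o k) (f \o k0) (g \o k0) =
  s \o pair2 (pi o20) (pi o21) f g \o k0.
Proof.
move=> tk HP' tf tg e tk0 ts.
have tpi := nfold_typed HP.
have [||| h' [th' ef' eg']] := pair_lift HP' (G := G') (f := f \o k0) (g := g \o k0);
  [typ|typ|by assocl; rewrite e|].
have [h [th ef eg]] := pair_lift HP tf tg e.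
rewrite ef' eg' (pair_eta HP' th') {1}ef {1}eg (pair_eta HP th).
assocr; congr (_ \o _); apply: (nfold_inj HP (G := G')); [typ|typ|].
have t0 := tpi o20; have t1 := tpi o21.
suff : pi o20 \o (k \o h') = pi o20 \o (h \o k0) /\
       pi o21 \o (k \o h') = pi o21 \o (h \o k0).
  by move=> [e0 e1] [[|[|i]] li] //; rewrite (bool_irrelevance li isT).
split; rewrite !vcompA; try by ends.
- by rewrite -ef' ef.
- by rewrite -eg' eg.
Qed.

End PairChange.

(** * Sums of 2-morphisms into a tangent bundle *)

Section Sums.
Variables (K : twoCat) (X : tangentad K).

Definition gsum (Z : K) (F : mor Z X) (f g : cell Z X) : cell Z X :=
  ts X *> F \o pair2 (tpi1 X *> F) (tpi2 X *> F) f g.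

Definition fibred (Z : K) (G F : mor Z X) (f g : cell Z X) : Prop :=
  [/\ typed f G (tT X * F), typed g G (tT X * F)
    & tp X *> F \o f = tp X *> F \o g].

Lemma typed_tpi1 : typed (tpi1 X) (tTn X 1) (tT X).
Proof. exact: typed_tpr. Qed.
Lemma typed_tpi2 : typed (tpi2 X) (tTn X 1) (tT X).
Proof. exact: typed_tpr. Qed.

Lemma gsum_pair (Z : K) (F G : mor Z X) (h : cell Z X) :
  typed h G (tTn X 1 * F) ->
  gsum F (tpi1 X *> F \o h) (tpi2 X *> F \o h) = ts X *> F \o h.
Proof. by move=> th; rewrite /gsum (pair_eta (Tn_pullback0 1 F) th). Qed.

Lemma fibred_pair (Z : K) (F G : mor Z X) (h : cell Z X) :
  typed h G (tTn X 1 * F) ->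
  fibred G F (tpi1 X *> F \o h) (tpi2 X *> F \o h).
Proof.
have t1 := typed_tpi1; have t2 := typed_tpi2.
move=> th; split; [typ|typ|assocl; congr (_ \o _)].
by have [_ /(_ o20 o21)] := Tn_pullback0 (X := X) 1 F.
Qed.

Lemma fibredP (Z : K) (F G : mor Z X) (f g : cell Z X) : fibred G F f g ->
  exists h, [/\ typed h G (tTn X 1 * F), f = tpi1 X *> F \o h
              & g = tpi2 X *> F \o h].
Proof.
by case=> tf tg e; apply: (pair_lift (Tn_pullback0 1 F) _ _ e); rewrite src_rw src_tp.
Qed.

Lemma gsum_typed (Z : K) (F G : mor Z X) (f g : cell Z X) : fibred G F f g ->
  typed (gsum F f g) G (tT X * F).
Proof. by case/fibredP=> h [th -> ->]; rewrite (gsum_pair th); typ. Qed.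

Lemma gsum_p (Z : K) (F G : mor Z X) (f g : cell Z X) : fibred G F f g ->
  tp X *> F \o gsum F f g = tp X *> F \o f.
Proof.
case/fibredP=> h [th -> ->]; rewrite (gsum_pair th); assocl; congr (_ \o _).
rewrite -!rw_vcomp; try by ends.
by rewrite [in LHS](ps (tangentP (tstruct X))).
Qed.

Lemma gsum_pre (Z : K) (F G G' : mor Z X) (f g h : cell Z X) : fibred G F f g ->
  typed h G' G -> gsum F f g \o h = gsum F (f \o h) (g \o h).
Proof.
have t1 := typed_tpi1; have t2 := typed_tpi2.
case/fibredP=> k [tk -> ->] th; rewrite (gsum_pair tk); assocr.
by rewrite (gsum_pair (G := G')) //; typ.
Qed.

Lemma fibred_rw (Z W : K) (H : mor W Z) (F G : mor Z X) (f g : cell Z X) :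
  fibred G F f g -> fibred (G * H) (F * H) (f *> H) (g *> H).
Proof.
move=> [tf tg e]; split; [typ|typ|].
by rewrite -!rw_rw -!rw_vcomp; [rewrite e | ends..].
Qed.

Lemma fibred_pre (Z : K) (F G G' : mor Z X) (f g h : cell Z X) :
  fibred G F f g -> typed h G' G -> fibred G' F (f \o h) (g \o h).
Proof.
move=> [tf tg e] th; split; [typ|typ|].
by assocl; rewrite e.
Qed.

Lemma gsum_rw (Z W : K) (H : mor W Z) (F G : mor Z X) (f g : cell Z X) :
  fibred G F f g -> gsum F f g *> H = gsum (F * H) (f *> H) (g *> H).
Proof.
have t1 := typed_tpi1; have t2 := typed_tpi2.
case/fibredP=> h [th -> ->]; rewrite (gsum_pair th); push.
by rewrite (gsum_pair (G := G * H)) //; typ.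
Qed.

(** Naturality of s, read on elements. *)
Lemma gsum_nat (Z : K) (F F' G : mor Z X) (a f g : cell Z X) :
  typed a F F' -> fibred G F f g ->
  tT X <* a \o gsum F f g = gsum F' (tT X <* a \o f) (tT X <* a \o g).
Proof.
have t1 := typed_tpi1; have t2 := typed_tpi2.
have ts' := s_typed (tangentP (tstruct X)); rewrite -/(ts X) in ts'.
move=> ta /fibredP[h [th -> ->]]; rewrite (gsum_pair th).
have e (b : cell X X) : typed b (tTn X 1) (tT X) ->
    tT X <* a \o (b *> F \o h) = b *> F' \o (tTn X 1 <* a \o h).
  move=> tb; rewrite (tail2 (esym (whisk_exchange ta tb))); try by ends.
  by assocr.
by rewrite !e // (gsum_pair (G := G)) //; typ.
Qed.

Lemma gsum1 (f g : cell X X) :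
  gsum (id1 (X : K)) f g = ts X \o pair2 (tpi1 X) (tpi2 X) f g.
Proof. by rewrite /gsum !rw1. Qed.

Lemma fibred_tpr (n : nat) (i j : 'I_n.+1) :
  fibred (tTn X n) (id1 (X : K)) (tpr X i) (tpr X j).
Proof.
by split; rewrite ?comp1r ?rw1; [exact: typed_tpr.. | exact: tp_tpr].
Qed.

Lemma gsum_comm (Z : K) (F G : mor Z X) (f g : cell Z X) :
  fibred G F f g -> gsum F g f = gsum F f g.
Proof.
have t1 := typed_tpi1; have t2 := typed_tpi2.
case/fibredP=> h [th -> ->]; rewrite (gsum_pair th).
have fib := fibred_tpr o21 o20.
have e : gsum (id1 (X : K)) (tpi2 X) (tpi1 X) = ts X.
  by rewrite gsum1; exact: (s_comm (tangentP (tstruct X))).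
by rewrite -[in RHS]e (gsum_rw F fib) comp1l (gsum_pre _ th) //;
  have := fibred_rw F fib; rewrite comp1l.
Qed.

(** The axioms on s concern projections of T_n, that is the universal elements;
    whiskering with F and precomposing with h carries them to all elements. *)
Lemma gsum_gen (Z : K) (F G : mor Z X) (h : cell Z X) (n : nat)
    (f g : cell X X) :
  fibred (tTn X n) (id1 (X : K)) f g -> typed h G (tTn X n * F) ->
  gsum F (f *> F \o h) (g *> F \o h) = gsum (id1 (X : K)) f g *> F \o h.
Proof.
move=> fib th; rewrite (gsum_rw F fib) comp1l (gsum_pre _ th) //.
by have := fibred_rw F fib; rewrite comp1l.
Qed.

(** The triple f, g, h is the image of the universal one, for which this is the
    associativity axiom of the tangent structure. *)
Lemma gsum_assoc (Z : K) (F G : mor Z X) (f g h : cell Z X) :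
  fibred G F f g -> fibred G F g h ->
  gsum F (gsum F f g) h = gsum F f (gsum F g h).
Proof.
move=> [tf tg efg] [_ th egh].
pose fs (k : 'I_3) := nth f [:: f; g; h] k.
have [||k tk ek] := nfold_lift (Tn_pullback0 (X := X) 2 F) (f := fs) (G := G).
- by rewrite src_rw src_tp => -[[|[|[|]]]].
- suff ef i : tp X *> F \o fs i = tp X *> F \o f by move=> i j; rewrite !ef.
  by case: i => [[|[|[|k]]] lk]; rewrite /fs //= efg ?egh.
rewrite -[f](ek o30) -[g](ek o31) -[h](ek o32).
have fib01 := fibred_tpr (n := 2) o30 o31; have fib12 := fibred_tpr (n := 2) o31 o32.
have [t0 t1 _] := fib01; have [_ t2 _] := fib12.
have A : gsum (id1 (X : K)) (gsum (id1 (X : K)) (tpr X o30) (tpr X o31)) (tpr X o32) =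
  gsum (id1 (X : K)) (tpr X o30) (gsum (id1 (X : K)) (tpr X o31) (tpr X o32)).
  by rewrite !gsum1; exact: (s_assoc (tangentP (tstruct X))).
rewrite !(gsum_gen _ tk) // ?A //; split=> //; try exact: gsum_typed.
- by rewrite (gsum_p fib12); case: fib01.
- by rewrite (gsum_p fib01); case: (fibred_tpr (n := 2) o30 o32).
Qed.

Lemma gsum_unit (Z : K) (F G : mor Z X) (f : cell Z X) :
  typed f G (tT X * F) -> gsum F (tz X *> F \o (tp X *> F \o f)) f = f.
Proof.
move=> tf.
have tz' := z_typed (tangentP (tstruct X)); have tp' := p_typed (tangentP (tstruct X)).
have pz' := pz (tangentP (tstruct X)).
rewrite -/(tz X) in tz' pz'; rewrite -/(tp X) in tp' pz'.
have tzp : typed (tz X \o tp X) (tT X) (tT X) by typ.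
have fib : fibred (tT X) (id1 (X : K)) (tz X \o tp X) (id2 (tT X)).
  split; [typ|typ|].
  rewrite !rw1; tail pz'; rewrite (vcomp_idl tp').
  by rewrite (vcomp_idr tp').
have e : gsum (id1 (X : K)) (tz X \o tp X) (id2 (tT X)) = id2 (tT X).
  by rewrite gsum1; exact: (s_unit (tangentP (tstruct X))).
have := gsum_rw F fib; rewrite e comp1l rw_id2 => e'.
have fib' := fibred_rw F fib; rewrite comp1l rw_id2 in fib'.
have := gsum_pre fib' tf; rewrite -e' (vcomp_idl tf) => e''; rewrite [RHS]e''.
by rewrite rw_vcomp; [assocr | ends].
Qed.

End Sums.

Section LaxSums.
Variables (K : twoCat) (X Y : tangentad K) (H : lax X Y).

Lemma fibred_lax (Z : K) (F G : mor Z X) (f g : cell Z X) : fibred G F f g ->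
  fibred (H * G) (H * F) (lcell H *> F \o H <* f) (lcell H *> F \o H <* g).
Proof.
move=> [tf tg e]; split; [typ|typ|].
have eH : tp Y *> (H * F) \o lcell H *> F = H <* (tp X *> F).
  by rewrite lw_rw -(lax_p (laxP H)) -rw_rw rw_vcomp //; ends.
rewrite !(tail2 eH); try by ends.
by rewrite -!lw_vcomp; [rewrite e | ends..].
Qed.

(** Compatibility of a tangent morphism with s is stated on the universal pair of
    projections; every other pair is obtained from it by precomposition. *)
Lemma lax_gsum (Z : K) (F G : mor Z X) (f g : cell Z X) : fibred G F f g ->
  lcell H *> F \o H <* gsum F f g =
  gsum (H * F) (lcell H *> F \o H <* f) (lcell H *> F \o H <* g).
Proof.
case/fibredP=> h [th -> ->]; rewrite (gsum_pair th).
have [tu u1 u2] := lax_pair H; have := lax_s (laxP H).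
set u := pair2 _ _ _ _ in tu u1 u2 * => es.
have t1 := typed_tpi1 X; have t2 := typed_tpi2 X.
have e (a : cell Y Y) (b : cell X X) : typed b (tTn X 1) (tT X) ->
    typed a (tTn Y 1) (tT Y) ->
    a *> H \o u = lcell H \o H <* b ->
    lcell H *> F \o H <* (b *> F \o h) = a *> (H * F) \o (u *> F \o H <* h).
  move=> tb ta eab; rewrite -rw_rw.
  have eF : a *> H *> F \o u *> F = lcell H *> F \o (H <* b) *> F.
    by rewrite -rw_vcomp ?eab ?rw_vcomp //; ends.
  by tail eF; norm.
rewrite !(e _ _ _ _ u1, e _ _ _ _ u2) //; try exact: typed_tpr.
rewrite (gsum_pair (G := H * G)); last by typ.
have eF : ts Y *> (H * F) \o u *> F = lcell H *> F \o (H <* ts X) *> F.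
  by rewrite -rw_rw -rw_vcomp -?es ?rw_vcomp //; ends.
by tail eF; norm.
Qed.

End LaxSums.

(** * The bundles T_n as tangent morphisms *)

Section TnInjective.
Variables (K : twoCat) (X : tangentad K).

Lemma Tn_inj m n (Z : K) (F G : mor Z X) (h h' : cell Z X) :
  typed h G (iter1 (tT X) m * tTn X n * F) ->
  typed h' G (iter1 (tT X) m * tTn X n * F) ->
  (forall k : 'I_n.+1, (iter1 (tT X) m <* tpr X k) *> F \o h =
             (iter1 (tT X) m <* tpr X k) *> F \o h') -> h = h'.
Proof.
move=> th th' e.
exact: (nfold_inj (Tn_pullback (tangentP (tstruct X)) n m F) th th' e).
Qed.

End TnInjective.

Section JointlyMonic.
Variables (K : twoCat) (Z X : tangentad K) (n : nat).
Variables (G : mor Z X) (F : 'I_n.+1 -> lax Z X) (r : 'I_n.+1 -> cell Z X).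

Definition jointly_monic (m : nat) : Prop :=
  forall (G' : mor Z X) (h h' : cell Z X),
  typed h G' (iter1 (tT X) m * G) -> typed h' G' (iter1 (tT X) m * G) ->
  (forall k, iter1 (tT X) m <* r k \o h = iter1 (tT X) m <* r k \o h') ->
  h = h'.

Hypothesis tr : forall k, typed (r k) G (F k).

Section Lax.
Variable a : cell Z X.
Hypothesis ta : typed a (G * tT Z) (tT X * G).
Hypothesis ra : forall k, tT X <* r k \o a = lcell (F k) \o r k *> tT Z.
Hypothesis jm : forall m, jointly_monic m.

Let jm0 (G' : mor Z X) (h h' : cell Z X) : typed h G' G -> typed h' G' G ->
  (forall k, r k \o h = r k \o h') -> h = h'.
Proof.
move=> th th' e; apply: (@jm 0 G'); rewrite /= ?comp1l // => k.
by rewrite lw1.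
Qed.

Let jm1 (G' : mor Z X) (h h' : cell Z X) :
  typed h G' (tT X * G) -> typed h' G' (tT X * G) ->
  (forall k, tT X <* r k \o h = tT X <* r k \o h') -> h = h'.
Proof. by move=> th th' e; apply: (@jm 1 G'); rewrite /= ?comp1r. Qed.

Let jm2 (G' : mor Z X) (h h' : cell Z X) :
  typed h G' (tT X * tT X * G) -> typed h' G' (tT X * tT X * G) ->
  (forall k, (tT X * tT X) <* r k \o h = (tT X * tT X) <* r k \o h') -> h = h'.
Proof. by move=> th th' e; apply: (@jm 2 G'); rewrite /= ?comp1r. Qed.

Let ex_r (c : cell X X) (H H' : mor X X) k : typed c H H' ->
  H' <* r k \o c *> G = c *> F k \o H <* r k.
Proof. by move=> tc; rewrite (whisk_exchange (tr k) tc). Qed.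

Let ex_l (c : cell Z Z) (H H' : mor Z Z) k : typed c H H' ->
  r k *> H' \o G <* c = F k <* c \o r k *> H.
Proof. by move=> tc; exact: (whisk_exchange tc (tr k)). Qed.

(** A 1-morphism that embeds jointly into tangent morphisms, compatibly with a,
    is a tangent morphism: each axiom takes place after T^m for some m at most 2,
    where the r_k are still jointly monic, and there it is the axiom for the F_k. *)
Lemma cone_lax_p : tp X *> G \o a = G <* tp Z.
Proof.
apply: (jm0 (G' := G * tT Z)); [typ|typ|move=> k; have tk := tr k].
have := ex_r k (p_typed (tangentP (tstruct X))); rewrite lw1 => e.
have := ex_l k (p_typed (tangentP (tstruct Z))); rewrite rw1 => ->.
by tail e; rewrite -vcompA; [rewrite ra; tail (lax_p (laxP (F k))) | ends..].
Qed.

Lemma cone_lax_z : a \o G <* tz Z = tz X *> G.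
Proof.
apply: (jm1 (G' := G)); [typ|typ|move=> k; have tk := tr k].
have := ex_r k (z_typed (tangentP (tstruct X))); rewrite lw1 => ->.
have := ex_l k (z_typed (tangentP (tstruct Z))); rewrite rw1 => e.
tail (ra k); assocr; rewrite e; tail (lax_z (laxP (F k))).
by [].
Qed.

Lemma cone_double k :
  (tT X * tT X) <* r k \o (tT X <* a \o a *> tT Z) =
  tT X <* lcell (F k) \o lcell (F k) *> tT Z \o r k *> (tT Z * tT Z).
Proof.
have tk := tr k.
have e : (tT X * tT X) <* r k \o tT X <* a =
         tT X <* lcell (F k) \o tT X <* r k *> tT Z.
  by rewrite -lw_lw -lw_vcomp; [rewrite ra lw_vcomp; [rewrite lw_rw|ends] | ends].
tail e; assocr.
by rewrite -rw_vcomp; [rewrite ra rw_vcomp; [rewrite rw_rw|ends] | ends].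
Qed.

Lemma cone_lax_l : tl X *> G \o a = tT X <* a \o a *> tT Z \o G <* tl Z.
Proof.
apply: (jm2 (G' := G * tT Z)); [typ|typ|move=> k; have tk := tr k].
have e := ex_r k (l_typed (tangentP (tstruct X))).
have e' := ex_l k (l_typed (tangentP (tstruct Z))).
tail e; rewrite vcompA; [|ends..]; rewrite cone_double.
assocr; rewrite ra e'; assocl; congr (_ \o _).
exact: lax_l (laxP (F k)).
Qed.

Lemma cone_lax_c : tc X *> G \o tT X <* a \o a *> tT Z =
  tT X <* a \o a *> tT Z \o G <* tc Z.
Proof.
apply: (jm2 (G' := G * (tT Z * tT Z))); [typ|typ|move=> k; have tk := tr k].
have e := ex_r k (c_typed (tangentP (tstruct X))).
have e' := ex_l k (c_typed (tangentP (tstruct Z))).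
assocr; tail e; assocr; rewrite cone_double [RHS]vcompA; [|ends..].
rewrite [RHS]vcompA; [|ends..]; rewrite -[_ \o _ \o a *> _]vcompA; [|ends..].
rewrite cone_double; assocr; rewrite e'; assocl; congr (_ \o _).
exact: lax_c (laxP (F k)).
Qed.

(** Both sides are compared after each T r_k; the sum over G becomes the sum over
    F_k by naturality of s, and F_k is a tangent morphism. *)
Lemma cone_lax_s : a \o G <* ts Z =
  gsum G (a \o G <* tpi1 Z) (a \o G <* tpi2 Z).
Proof.
have t1 := typed_tpi1 Z; have t2 := typed_tpi2 Z.
have fib : fibred (G * tTn Z 1) G (a \o G <* tpi1 Z) (a \o G <* tpi2 Z).
  split; [typ|typ|].
  tail cone_lax_p; tail cone_lax_p; rewrite -!lw_vcomp; try by ends.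
  by rewrite (tp_tpr _ o20 o21).
have tg := gsum_typed fib.
apply: (jm1 (G' := G * tTn Z 1)); [typ|typ|move=> k; have tk := tr k].
rewrite (gsum_nat tk fib).
have e (b : cell Z Z) (H : mor Z Z) : typed b H (tT Z) ->
    tT X <* r k \o (a \o G <* b) = lcell (F k) \o F k <* b \o r k *> H.
  move=> tb; tail (ra k); assocr.
  by rewrite (ex_l k tb).
rewrite (e _ _ t1) (e _ _ t2) (e _ _ (s_typed (tangentP (tstruct Z)))).
have [tu u1 u2] := lax_pair (F k).
have fibF : fibred (F k * tTn Z 1) (F k) (lcell (F k) \o F k <* tpi1 Z)
     (lcell (F k) \o F k <* tpi2 Z).
  by have := fibred_pair tu; rewrite u1 u2.
rewrite -(gsum_pre fibF (typed_rw _ tk)).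
by congr (_ \o _); exact: (lax_s (laxP (F k))).
Qed.

Lemma cone_lax : isLax G a.
Proof.
split=> //; [exact: cone_lax_p | exact: cone_lax_z | exact: cone_lax_s
  | exact: cone_lax_l | exact: cone_lax_c].
Qed.

End Lax.
End JointlyMonic.

Section Reflect.
Variables (K : twoCat) (Z X : tangentad K) (n : nat).
Variables (P : lax Z X) (F : 'I_n.+1 -> lax Z X) (r : 'I_n.+1 -> cell Z X).
Hypothesis tr : forall k, is_tangent2 P (F k) (r k).
Hypothesis jm : jointly_monic P r 1.

(** Makes a pullback of 2-morphisms a pullback among tangent 2-morphisms. *)
Lemma tangent2_reflect (G : lax Z X) (h : cell Z X) : typed h G P ->
  (forall k, is_tangent2 G (F k) (r k \o h)) -> is_tangent2 G P h.
Proof.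
move=> th tan; split=> //.
apply: (jm (G' := G * tT Z)); rewrite /= ?comp1r; [typ|typ|move=> k].
have [tk ek] := tr k; have [_ e] := tan k.
rewrite (tail2 ek); try by ends.
move: e; rewrite lw_vcomp; [|ends]; rewrite rw_vcomp; [|ends].
by assocr.
Qed.

End Reflect.

Section TnLax.
Variables (K : twoCat) (X : tangentad K) (n : nat).

Lemma Tn_jointly_monic m :
  jointly_monic (tTn X n) (fun k : 'I_n.+1 => tpr X k) m.
Proof.
move=> G h h' th th' e; apply: (@Tn_inj _ X m n _ (id1 (X : K)) G); rewrite ?comp1r //.
by move=> k; rewrite rw1.
Qed.

(** Since T T_n is again a pullback, a 2-morphism into it is given by its
    components; here the component at each factor is c. *)
Lemma Tn_cell_exists : exists2 a,
  typed a (tTn X n * tT X) (tT X * tTn X n)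
  & forall k : 'I_n.+1, tT X <* tpr X k \o a = tc X \o tpr X k *> tT X.
Proof.
have HP := Tn_pullback1 (X := X) n (id1 (X : K)).
have [|| a ta ea] := nfold_lift HP (f := fun k => tc X \o tpr X k *> tT X)
  (G := tTn X n * tT X).
- by move=> k; typ.
- move=> i j; rewrite !rw1 -!(pT_c (tangentP (tstruct X))).
  rewrite -[dc _]/(tc X) -[dp _]/(tp X) -[dT _]/(tT X).
  have cc : tc X \o tc X = id2 (tT X * tT X) by exact: (c_c (tangentP (tstruct X))).
  assocr; rewrite !(tail2 cc); try by ends.
  rewrite !(vcomp_idl (F := tTn X n * tT X)); try typ.
  by rewrite -!rw_vcomp; [rewrite (tp_tpr _ i j) | ends..].
exists a; first by rewrite comp1r in ta.
by move=> k; rewrite -ea rw1.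
Qed.

Definition Tn_cell : cell X X := sval (cid2 Tn_cell_exists).

Lemma Tn_cell_typed : typed Tn_cell (tTn X n * tT X) (tT X * tTn X n).
Proof. by rewrite /Tn_cell; case: cid2. Qed.

Lemma Tn_cellE (k : 'I_n.+1) :
  tT X <* tpr X k \o Tn_cell = tc X \o tpr X k *> tT X.
Proof. by rewrite /Tn_cell; case: cid2. Qed.

Lemma lax_TnP : isLax (X := X) (Y := X) (tTn X n) Tn_cell.
Proof.
apply: (@cone_lax K X X n (tTn X n) (fun=> lax_T X) (fun k => tpr X k)).
- by move=> k; exact: typed_tpr.
- exact: Tn_cell_typed.
- exact: Tn_cellE.
- exact: Tn_jointly_monic.
Qed.

Definition lax_Tn : lax X X := Lax lax_TnP.

Lemma tangent2_tpr (k : 'I_n.+1) : is_tangent2 lax_Tn (lax_T X) (tpr X k).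
Proof. by split; [exact: typed_tpr | exact: Tn_cellE]. Qed.

End TnLax.

(** * Strict tangent morphisms *)

Section StrictFacts.
Variables (K : twoCat) (X Y : tangentad K) (F : lax X Y).
Hypothesis sF : is_strict F.

Lemma strict_T : tT Y * F = F * tT X.
Proof. by rewrite -(tgt_lcell F) sF tgt_id2. Qed.

Lemma strict_lcell_src (a : cell X Y) : src a = F * tT X -> a \o lcell F = a.
Proof. by rewrite sF => <-; rewrite vcompr. Qed.

Lemma strict_lcell_tgt (a : cell X Y) : tgt a = F * tT X -> lcell F \o a = a.
Proof. by rewrite sF => <-; rewrite vcompl. Qed.

Lemma strict_p : F <* tp X = tp Y *> F.
Proof. by rewrite -(lax_p (laxP F)) strict_lcell_src //; ends; exact: strict_T. Qed.

Lemma strict_z : F <* tz X = tz Y *> F.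
Proof. by rewrite -(lax_z (laxP F)) strict_lcell_tgt //; ends. Qed.

Lemma strict_double :
  tT Y <* lcell F \o lcell F *> tT X = id2 (F * tT X * tT X).
Proof.
by rewrite sF lw_id2 rw_id2 comp1A strict_T vcomp_id2.
Qed.

Lemma strict_l : F <* tl X = tl Y *> F.
Proof.
have := lax_l (laxP F); rewrite strict_double strict_lcell_src => [->|].
  by rewrite (vcomp_idl (F := F * tT X)) //; typ.
by ends; exact: strict_T.
Qed.

Lemma strict_c : F <* tc X = tc Y *> F.
Proof.
have := lax_c (laxP F); rewrite -vcompA; try by ends.
rewrite strict_double (vcomp_idl (F := F * tT X * tT X)); last by typ.
move=> <-; rewrite (vcomp_idr (G := tT Y * tT Y * F)) //.
by split; ends; rewrite -comp1A strict_T comp1A strict_T.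
Qed.

Lemma strict_lcell_rw (Z : K) (G : mor Z X) (a : cell Z Y) :
  tgt a = F * tT X * G -> lcell F *> G \o a = a.
Proof. by rewrite sF rw_id2 => <-; rewrite vcompl. Qed.

Lemma strict_gsum (Z : K) (G G' : mor Z X) (f g : cell Z X) :
  fibred G' G f g -> F <* gsum G f g = gsum (F * G) (F <* f) (F <* g).
Proof.
move=> fib; have := lax_gsum F fib; have tg := gsum_typed fib.
by case: fib => tf tg' _; rewrite !strict_lcell_rw //; ends.
Qed.

(** The vector field on F T induced by w is c \o T w, because the compatibility of w
    with the structure cells reads T w = c \o w_T when those cells are identities,
    and c is an involution. *)
Lemma strict_field (w : cell X Y) :
  is_tangent2 F (lax_comp (lax_T Y) F) w ->
  w *> tT X = tc Y *> F \o tT Y <* w.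
Proof.
move=> [tw ew].
have eT := strict_T.
have {ew} -> : tT Y <* w = tc Y *> F \o w *> tT X.
  rewrite -[LHS]strict_lcell_src ?ew /= /lax_comp_cell /=; last by ends.
  rewrite sF lw_id2 (vcomp_idr (G := tT Y * tT Y * F)) //.
  by split; ends; rewrite -?comp1A ?eT.
have cc : tc Y *> F \o tc Y *> F = id2 (tT Y * tT Y * F).
  by rewrite -rw_vcomp; [rewrite (c_c (tangentP (tstruct Y))) rw_id2 | ends].
have eTT : tT Y * F * tT X = tT Y * tT Y * F by rewrite -!comp1A eT.
by rewrite (tail2 cc) ?(vcomp_idl (F := F * tT X)) //; try split; ends.
Qed.

End StrictFacts.

(** * The universal property of the tangentad of vector fields *)

Section Categories.
Local Open Scope cat_scope.

(** Functors are compared by equality, so the source and target of E f are those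
    of f only propositionally; stating the consequences of E = id for a variable
    E lets them follow by substitution, without transports. *)
Lemma endofunctor_id_inj (C : category) (E : functor C C) :
  E = functor_id C -> forall (A B : C) (a b : chom A B),
  fmap E a = fmap E b -> a = b.
Proof. by move=> ->. Qed.

Lemma endofunctor_id_surj (C : category) (E : functor C C) :
  E = functor_id C -> forall (A B : C) (f : chom (E A) (E B)),
  exists a : chom A B, fmap E a = f.
Proof. by move=> -> A B f; exists f. Qed.

Section Invertible.
Variables (C D : category) (F : functor C D).
Hypothesis iF : invertible F.

Lemma invertible_ob_inj (A B : C) : F A = F B -> A = B.
Proof.
case: iF => G [e _] eF.
have <- : functor_comp G F A = A by rewrite e.
by rewrite /= eF -[RHS]/(functor_id C B) -e.
Qed.

Lemma invertible_ob_surj (B : D) : exists A, F A = B.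
Proof.
case: iF => G [_ e]; exists (G B).
by rewrite -[LHS]/(functor_comp F G B) e.
Qed.

Lemma invertible_faithful (A B : C) (a b : chom A B) :
  fmap F a = fmap F b -> a = b.
Proof.
by case: iF => G [e _] eF; apply: (endofunctor_id_inj e); rewrite /= eF.
Qed.

(** A preimage of f is a lift of G f through G F = id; it is sent to f because G
    is faithful. *)
Lemma invertible_full (A B : C) (f : chom (F A) (F B)) :
  exists a, fmap F a = f.
Proof.
case: iF => G [e e'].
have [a ea] := endofunctor_id_surj e (fmap G f : chom (functor_comp G F A) _).
exists a; apply: (endofunctor_id_inj e').
by rewrite /=; congr (fmap F _).
Qed.

End Invertible.
End Categories.

Lemma vfObj_eq (K : twoCat) (X Y : tangentad K) (A B : vfHomTng X Y) :
  vbase A = vbase B -> vfcell A = vfcell B -> A = B.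
Proof.
case: A B => [F [[a ta] pa]] [G [[b tb] pb]] /= e; subst G.
rewrite /vfcell /= => e; subst b.
have e : ta = tb by exact: Prop_irrelevance.
by subst tb; rewrite (Prop_irrelevance pa pb).
Qed.

Section Universal.
Variables (K : twoCat) (X : tangentad K) (C : vfConstruction X).
Let V : tangentad K := VF C.
Let U : lax V X := VFU C.

Definition ucell : cell (VF C) X := sval (vf (VFv C)).
Let v : cell V X := ucell.

Lemma ucell_tangent : is_tangent2 U (lax_comp (lax_T X) U) v.
Proof. exact: (svalP (vf (VFv C))). Qed.

Lemma ucell_typed : typed v U (tT X * U).
Proof. by case: ucell_tangent. Qed.

Lemma ucell_p : tp X *> U \o v = id2 U.
Proof. exact: (congr1 sval (vfP (VFv C))). Qed.

Variable W : tangentad K.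

Lemma VF_mor_inj (H G : lax W V) :
  lax_comp U H = lax_comp U G -> v *> H = v *> G -> H = G.
Proof.
move=> eU ev; apply: (invertible_ob_inj (VF_universal C W)).
exact: vfObj_eq.
Qed.

Lemma VF_mor_lift (F : lax W X) (w : cell W X) :
  is_tangent2 F (lax_comp (lax_T X) F) w -> tp X *> F \o w = id2 F ->
  exists H : lax W V, lax_comp U H = F /\ v *> H = w.
Proof.
move=> tw pw.
have pP : ccomp (pbar F) (exist _ w tw : chom (F : homTng W X) (Tbar W X F))
      = Defs.cid (F : homTng W X).
  exact: sval_eq.
pose A : vfHomTng W X := VfObj (VectorField pP).
have [H eH] := invertible_ob_surj (VF_universal C W) A.
exists H; split; first exact: (congr1 (@vbase _ _ _) eH).
exact: (congr1 (@vfcell _ _ _) eH).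
Qed.

Lemma VF_cell_inj (H G : lax W V) (a b : cell W V) :
  is_tangent2 H G a -> is_tangent2 H G b -> U <* a = U <* b -> a = b.
Proof.
move=> ta tb e.
have := @invertible_faithful _ _ _ (VF_universal C W) H G (exist _ a ta) (exist _ b tb).
by move=> /(_ _)/(congr1 sval); apply; do 2 apply: sval_eq.
Qed.

Lemma VF_cell_lift (H G : lax W V) (w : cell W X) :
  is_tangent2 (lax_comp U H) (lax_comp U G) w ->
  tT X <* w \o v *> H = v *> G \o w ->
  exists2 a, is_tangent2 H G a & U <* a = w.
Proof.
move=> tw ew.
pose f1 : chom (lax_comp U H : homTng W X) (lax_comp U G) := exist _ w tw.
have ef : ccomp (fmap (Tbar W X) f1) (vfield (Gamma_ob (VFv C) H)) =
   ccomp (vfield (Gamma_ob (VFv C) G)) f1 by exact: sval_eq.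
have [[a ta] ea] := @invertible_full _ _ _ (VF_universal C W) H G (exist _ f1 ef).
by exists a => //; exact: (congr1 (fun x => sval (sval x)) ea).
Qed.

(** The compatibility of H with c says exactly this. *)
Lemma tangent2_lcell (Y : tangentad K) (H : lax W Y) :
  is_tangent2 (lax_comp H (lax_T W)) (lax_comp (lax_T Y) H) (lcell H).
Proof.
split; first exact: lax_typed (laxP H).
rewrite /= /lax_comp_cell /=; assocl.
exact: esym (lax_c (laxP H)).
Qed.

(** The structure cell of H is a tangent 2-morphism from H T to T H.  When U H is
    strict, its image under U is an identity, and H T and T H have the same image
    under U and the same vector field, so they are equal and the cell is an
    identity. *)
Lemma VF_strict_reflect (H : lax W V) :
  is_strict (lax_comp U H) -> is_strict H.
Proof.
move=> sUH; have sU : is_strict U := strictP (VFU C).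
have eid : U <* lcell H = id2 (U * H * tT W).
  by rewrite -sUH /= /lax_comp_cell strict_lcell_rw //; ends;
    rewrite -comp1A -(strict_T sU) comp1A.
have emor : U * (H * tT W) = U * (tT V * H).
  have := congr1 (@tgt K _ _) eid; rewrite tgt_id2 tgt_lw tgt_lcell => ->.
  by rewrite comp1A.
have eH : lax_comp H (lax_T W) = lax_comp (lax_T V) H.
  apply: VF_mor_inj; last first.
    rewrite /= -!rw_rw (strict_field sU ucell_tangent).
    have tUH : is_tangent2 (lax_comp U H) (lax_comp (lax_T X) (lax_comp U H)) (v *> H).
      by rewrite lax_compA; apply: tangent2_rw; exact: ucell_tangent.
    rewrite (strict_field sUH tUH) rw_vcomp; last by have tv := ucell_typed; ends.
    by rewrite lw_rw rw_rw.
  apply: lax_eq; first exact: emor.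
  have eU := strict_T sU.
  have eUH := strict_T sUH; rewrite /= in eUH.
  have eUHT : U * tT V * H * tT W = U * H * tT W * tT W.
    by rewrite -[U * tT V * H]comp1A -emor comp1A.
  rewrite /= [LHS]/lax_comp_cell [RHS]/lax_comp_cell /=.
  rewrite !(strict_lcell_rw sU); try by rewrite /lax_comp_cell; ends;
    rewrite -?[U * tT V * H]comp1A -?emor ?comp1A.
  rewrite /lax_comp_cell /= !lw_vcomp; try by ends.
  have e1 : U <* (lcell H *> tT W) = id2 (U * H * tT W * tT W).
    by rewrite lw_rw eid rw_id2.
  have e2 : U <* (tT V <* lcell H) = id2 (tT X * (U * H * tT W)).
    by rewrite lw_lw -eU -lw_lw eid lw_id2.
  rewrite e1 e2 !(lw_lw, lw_rw) (strict_c sU).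
  have := strict_c sUH; rewrite /= => ->.
  have e4 : tT X * tT X * (U * H) = U * H * tT W * tT W.
    by rewrite -comp1A eUH comp1A eUH.
  rewrite [in RHS]rw_rw (vcomp_idl (F := tT X * tT X * (U * H))); last first.
    by split; ends; rewrite -e4 comp1A.
  by rewrite -eUH comp1A (vcomp_idr (G := tT X * tT X * (U * H))) //; typ.
have := tangent2_lcell H; rewrite -eH => tH.
have eHT : tT V * H = H * tT W by rewrite -[tT V * H](congr1 (@lmor _ _ _) eH).
rewrite /is_strict; apply: (VF_cell_inj tH); last first.
  by rewrite eid lw_id2 comp1A.
exact: (tangent2_id (lax_comp H (lax_T W))).
Qed.

End Universal.

(** * The forgetful morphism and the pullbacks T_n *)

Lemma strict_lax_T (K : twoCat) (X Y : tangentad K) (F : lax X Y) :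
  is_strict F -> lax_comp F (lax_T X) = lax_comp (lax_T Y) F.
Proof.
move=> sF; apply: lax_eq; rewrite /= ?(strict_T sF) // /lax_comp_cell /=.
have eF := strict_T sF.
rewrite (strict_lcell_rw sF); last by ends; rewrite -?comp1A ?eF ?comp1A ?eF.
rewrite (strict_c sF) sF lw_id2 (vcomp_idr (G := tT Y * tT Y * F)) //.
by split; ends; rewrite -?comp1A ?eF.
Qed.

Lemma tangent2_tc (K : twoCat) (X : tangentad K) :
  is_tangent2 (lax_comp (lax_T X) (lax_T X))
    (lax_comp (lax_T X) (lax_T X)) (tc X).
Proof.
split; first exact: c_typed (tangentP (tstruct X)).
by rewrite /= /lax_comp_cell /=; assocl; exact: (Tc_c_Tc (tangentP (tstruct X))).
Qed.

Section FieldOnTn.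
Variables (K : twoCat) (X : tangentad K) (C : vfConstruction X) (n : nat).
Let V : tangentad K := VF C.
Let U : lax V X := VFU C.
Let v : cell V X := ucell C.
Let sU : is_strict U. Proof. exact: strictP (VFU C). Qed.
Let eU : tT X * U = U * tT V. Proof. exact: strict_T sU. Qed.
Let tv : typed v U (tT X * U). Proof. exact: ucell_typed. Qed.
Let TnU : lax V X := lax_comp (lax_Tn X n) U.
Let r (k : 'I_n.+1) : cell V X := tpr X k *> U.
Let jm m : jointly_monic TnU r m.
Proof.
move=> G h h' th th' e.
apply: (@Tn_inj _ X m n _ U G); rewrite -?comp1A // => k.
by rewrite -lw_rw; exact: e.
Qed.

Let tr (k : 'I_n.+1) : is_tangent2 TnU (lax_comp (lax_T X) U) (r k).
Proof. by apply: tangent2_rw; exact: tangent2_tpr. Qed.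

(** The vector field on T_n U is c \o T v on each factor, as for the tangent bundle
    in the tangent category of vector fields. *)
Lemma Tn_field_exists : exists2 w : cell V X,
  typed w (tTn X n * U) (tT X * (tTn X n * U))
  & forall k, tT X <* r k \o w = tc X *> U \o (tT X <* v \o r k).
Proof.
have HP := Tn_pullback1 (X := X) n U.
have e1 (k : 'I_n.+1) : (tT X <* tp X) *> U \o (tc X *> U \o (tT X <* v \o r k)) =
    v \o (tp X *> U \o r k).
  have eTp : (tT X <* tp X) *> U \o tc X *> U = (tp X *> tT X) *> U.
    rewrite -(pT_c (tangentP (tstruct X))) -[dc _]/(tc X) -[dp _]/(tp X) -[dT _]/(tT X).
    rewrite -rw_vcomp; last by ends.
    rewrite -vcompA; try by ends.
    have cc : tc X \o tc X = id2 (tT X * tT X) by exact: (c_c (tangentP (tstruct X))).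
    by rewrite cc (vcomp_idr (G := tT X)) //; typ.
  tail eTp; rewrite rw_rw.
  have e := whisk_exchange tv (p_typed (tangentP (tstruct X))).
  rewrite lw1 in e; tail e.
  by assocr.
have [|| w tw ew] := nfold_lift HP
  (f := fun k => tc X *> U \o (tT X <* v \o r k)) (G := tTn X n * U).
- by move=> k; rewrite /r; typ.
- move=> i j; rewrite !e1; congr (_ \o _); rewrite /r -!rw_vcomp; try by ends.
  by rewrite (tp_tpr _ i j).
exists w; first by rewrite comp1A.
by move=> k; rewrite -ew /r lw_rw.
Qed.

(** The endomorphism H of V that classifies this vector field; the projections of
    T_n U commute with the vector fields, hence lift to H. *)
Lemma VF_Tn_exists : exists (H : lax V V) (rho : 'I_n.+1 -> cell V V),
  [/\ lax_comp U H = TnU,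
      forall k, tT X <* r k \o v *> H = tc X *> U \o (tT X <* v \o r k),
      forall k, is_tangent2 H (lax_T V) (rho k)
    & forall k, U <* rho k = r k].
Proof.
have [w tw ew] := Tn_field_exists.
have tanw : is_tangent2 TnU (lax_comp (lax_T X) TnU) w.
  apply: (@tangent2_reflect _ _ _ n (lax_comp (lax_T X) TnU)
    (fun=> lax_comp (lax_T X) (lax_comp (lax_T X) U)) (fun k => tT X <* r k)) => //.
  + by move=> k; apply: (tangent2_lw (lax_T X)); exact: tr.
  + move=> G h h' th th' e; apply: (@jm 2 G); rewrite /= ?comp1r -?comp1A // in th th' *.
    by move=> k; have := e k; rewrite /= comp1r lw_lw.
  + move=> k; rewrite ew; apply: tangent2_comp.
      have := tangent2_rw U (tangent2_tc X); rewrite -lax_compA; apply.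
    apply: tangent2_comp (tr k).
    exact: (tangent2_lw (lax_T X) (ucell_tangent C)).
have pw : tp X *> TnU \o w = id2 TnU.
  apply: (@jm 0 TnU); rewrite /= ?comp1l; [typ|typ|move=> k].
  have [trk _] := tr k.
  have e := whisk_exchange trk (p_typed (tangentP (tstruct X))).
  rewrite lw1 /= in e; rewrite lw1 (tail2 (esym e)); try by ends.
  have eTp : tp X *> (tT X * U) \o tc X *> U = tT X <* (tp X *> U).
    rewrite lw_rw -(pT_c (tangentP (tstruct X))) -[dc _]/(tc X) -[dp _]/(tp X) -[dT _]/(tT X).
    by rewrite rw_vcomp ?rw_rw //; ends.
  have ev : tT X <* (tp X *> U) \o tT X <* v = id2 (tT X * U).
    by rewrite -lw_vcomp; [rewrite ucell_p lw_id2 | ends].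
  have tr' : typed (r k) (tTn X n * U) (tT X * U) by [].
  rewrite -vcompA; [rewrite ew|ends..].
  by tail eTp; tail ev; rewrite (vcomp_idl tr') (vcomp_idr tr').
have [H [eH ev]] := VF_mor_lift C tanw pw.
have eUT := strict_lax_T sU.
have lift (k : 'I_n.+1) : exists2 a, is_tangent2 H (lax_T V) a & U <* a = r k.
  apply: VF_cell_lift.
    by rewrite eH eUT; exact: tr.
  by rewrite ev ew (strict_field sU (ucell_tangent C)); assocr.
exists H, (fun k => s2val (cid2 (lift k))).
by split=> [|k|k|k]; rewrite ?ev //; case: cid2.
Qed.

(** T_n and H are both pullbacks of p among tangent morphisms, so they are
    isomorphic: the comparison k exists because T_n is a pullback in V, and its
    inverse is the lift of the canonical comparison w from U T_n to T_n U, which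
    commutes with the vector fields.  In particular w is invertible. *)
Lemma VF_Tn_iso : exists (H : mor V V) (k k' : cell V V),
  [/\ typed k H (tTn V n), typed k' (tTn V n) H, k \o k' = id2 (tTn V n),
      k' \o k = id2 H
    & U * H = tTn X n * U /\
      forall i : 'I_n.+1, U <* (tpr V i \o k) = tpr X i *> U].
Proof.
have [H [rho [eH eV tanrho erho]]] := VF_Tn_exists.
have eUH : U * H = tTn X n * U := congr1 (@lmor _ _ _) eH.
have eUT := strict_lax_T sU.
have trho i : typed (rho i) H (tT V) by case: (tanrho i).
have tUr (i : 'I_n.+1) : typed (U <* tpr V i) (U * tTn V n) (tT X * U).
  by have ti := typed_tpr V i; rewrite eU; typ.
(* k, from H to T_n: p \o rho i is independent of i because it is after U *)
have HV := Tn_pullback0 (X := V) n (id1 (V : K)).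
have [|| k tk ek] := nfold_lift HV (f := rho) (G := H).
- by move=> i; rewrite rw1 src_tp.
- move=> i j; rewrite rw1.
  apply: (VF_cell_inj (C := C) (H := H) (G := lax_id V)).
  + exact: tangent2_comp (tangent2_tp V) (tanrho i).
  + exact: tangent2_comp (tangent2_tp V) (tanrho j).
  + have ti := trho i; have tj := trho j.
    rewrite !lw_vcomp; try by ends.
    rewrite (strict_p sU) !erho /r -!rw_vcomp; try by ends.
    by rewrite (tp_tpr _ i j).
rewrite comp1r in tk.
have {}ek i : tpr V i \o k = rho i by rewrite -ek rw1.
have tank : is_tangent2 H (lax_Tn V n) k.
  apply: (tangent2_reflect (F := fun=> lax_T V) (r := fun i => tpr V i)) => //.
  + by move=> i; exact: tangent2_tpr.
  + exact: Tn_jointly_monic.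
  + by move=> i; rewrite ek.
(* w, from U T_n to T_n U, with components U pr_i; it commutes with the vector
   fields on each factor, where both sides are c \o T v \o U pr_i *)
have [|| w tw ew] := nfold_lift (Tn_pullback0 (X := X) n U)
  (f := fun i => U <* tpr V i) (G := U * tTn V n).
- by move=> i; rewrite src_rw src_tp.
- move=> i j; rewrite -!(strict_p sU) -!lw_vcomp; try by ends.
  by rewrite (tp_tpr _ i j).
have {}ew i : r i \o w = U <* tpr V i := ew i.
have tanw : is_tangent2 (lax_comp U (lax_Tn V n)) TnU w.
  apply: (tangent2_reflect (F := fun=> lax_comp (lax_T X) U) (r := r)) => //.
  move=> i; rewrite ew -eUT; apply: tangent2_lw; exact: tangent2_tpr.
have [k' tank' ek'] : exists2 k', is_tangent2 (lax_Tn V n) H k' & U <* k' = w.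
  apply: VF_cell_lift; first by rewrite eH.
  have tH : typed (v *> H) (tTn X n * U) (tT X * (tTn X n * U)).
    by rewrite -eUH; typ.
  apply: (@jm 1 (U * tTn V n)); rewrite /= ?comp1r;
    [typ | exact: typed_comp tH tw | move=> i].
  have ti : typed (r i) (tTn X n * U) (tT X * U) by case: (tr i).
  have e1 : tT X <* r i \o tT X <* w = (tT X * U) <* tpr V i.
    by rewrite -lw_vcomp; [rewrite ew lw_lw | ends].
  have e2 := whisk_exchange (typed_tpr V i) tv.
  tail e1; rewrite -e2 (strict_field sU (ucell_tangent C)).
  rewrite (tail2 (eV i)); [ | by rewrite (proj2 tw) (proj1 tH)
    | by rewrite (proj2 tH); ends].
  by assocr; rewrite ew.
exists H, k, k'.
have [tk' _] := tank'; rewrite /= in tk'.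
have ekk' : k \o k' = id2 (tTn V n).
  apply: (@Tn_jointly_monic _ V n 0 (tTn V n)); rewrite /= ?comp1l;
    [typ | typ | move=> i].
  rewrite lw1 (vcomp_idr (typed_tpr V i)); tail (ek i).
  apply: (VF_cell_inj (C := C) (H := lax_Tn V n) (G := lax_T V)).
  - exact: tangent2_comp (tanrho i) tank'.
  - exact: tangent2_tpr.
  - by have ti := trho i; rewrite lw_vcomp ?erho ?ek' ?ew //; ends.
split=> //; last by split=> // i; rewrite ek erho.
apply: (VF_cell_inj (C := C) (H := H) (G := H)).
- exact: tangent2_comp tank' tank.
- exact: tangent2_id.
- rewrite lw_vcomp; last by ends.
  rewrite ek' lw_id2 eUH.
  have tUk : typed (U <* k) (tTn X n * U) (U * tTn V n) by rewrite -eUH; typ.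
  apply: (@jm 0 (tTn X n * U)); rewrite /= ?comp1l; [typ | typ | move=> i].
  have ti : typed (r i) (tTn X n * U) (tT X * U) by case: (tr i).
  rewrite lw1 (vcomp_idr ti); tail (ew i).
  by rewrite -lw_vcomp ?ek ?erho //; ends.
Qed.

End FieldOnTn.

(** * Changing the chosen pullbacks T_n *)

Section ChangeOfPullbacks.
Variables (K : twoCat) (X : tangentad K).
Variables (H : nat -> mor X X) (k k' : nat -> cell X X).
Hypothesis tk : forall n, typed (k n) (H n) (tTn X n).
Hypothesis tk' : forall n, typed (k' n) (tTn X n) (H n).
Hypothesis kk' : forall n, k n \o k' n = id2 (tTn X n).
Hypothesis k'k : forall n, k' n \o k n = id2 (H n).

Definition changed_data : tangentData X :=
  @TangentData K X (tT X) H (fun n i => tpr X i \o k n) (tp X) (tz X)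
    (ts X \o k 1) (tl X) (tc X).

Let A := tangentP (tstruct X).

Lemma changed_pullback n m : pointwise_nfold_pullback2 (iter1 (tT X) m * H n)
  (fun i : 'I_n.+1 => iter1 (tT X) m <* (tpr X i \o k n))
  (iter1 (tT X) m <* tp X).
Proof.
move=> Z F; have tkn := tk n; have tkn' := tk' n.
have := nfold_iso (Tn_pullback A n m F) (k := (iter1 (tT X) m <* k n) *> F)
  (k' := (iter1 (tT X) m <* k' n) *> F) (P' := iter1 (tT X) m * H n * F).
move=> /(_ _ _ _ _)/=; set f := fun i => _; set g := fun i => _.
have -> : f = g.
  by apply/funext=> i; rewrite /f /g lw_vcomp ?rw_vcomp //; ends.
apply; [typ|typ| |].
- by rewrite -rw_vcomp -?lw_vcomp ?kk' ?lw_id2 ?rw_id2 //; ends.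
- by rewrite -rw_vcomp -?lw_vcomp ?k'k ?lw_id2 ?rw_id2 //; ends.
Qed.

Lemma changed_pullback0 n :
  is_nfold_pullback2 (H n) (fun i : 'I_n.+1 => tpr X i \o k n) (tp X).
Proof.
have := changed_pullback n 0 (id1 (X : K)); rewrite comp1r comp1l rw1 /= lw1.
by under eq_fun => i do rewrite rw1 lw1.
Qed.

(** The new addition has the same values as the old one, so its laws follow from
    those of [gsum]. *)
Lemma changed_sum (G : mor X X) (f g : cell X X) : fibred G (id1 (X : K)) f g ->
  ts X \o k 1 \o pair2 (tpi1 X \o k 1) (tpi2 X \o k 1) f g =
  gsum (id1 (X : K)) f g.
Proof.
have tk1 := tk 1; have t1 := typed_tpi1 X; have t2 := typed_tpi2 X.
move=> [tf tg e]; rewrite comp1r !rw1 in tf tg e.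
rewrite -src_tp in tf tg.
have [h [th -> ->]] := pair_lift (changed_pullback0 1) tf tg e.
rewrite (pair_eta (changed_pullback0 1) th); assocr.
have := @gsum_pair _ X _ (id1 (X : K)) G (k 1 \o h); rewrite !rw1 => ->//.
by rewrite comp1r; typ.
Qed.

Lemma changed_Tsum (f g : cell X X) :
  typed f (tTn X 1) (tT X * tT X) -> typed g (tTn X 1) (tT X * tT X) ->
  tT X <* tp X \o f = tT X <* tp X \o g ->
  tT X <* (ts X \o k 1) \o pair2 (tT X <* (tpi1 X \o k 1))
    (tT X <* (tpi2 X \o k 1)) (f \o k 1) (g \o k 1) =
  tT X <* ts X \o pair2 (tT X <* tpi1 X) (tT X <* tpi2 X) f g \o k 1.
Proof.
have tk1 := tk 1; have t1 := typed_tpi1 X; have t2 := typed_tpi2 X.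
move=> tf tg e; rewrite !lw_vcomp; try by ends.
apply: (@pair_change _ _ _ _ _ _ (pointwise_id (Tn_pullback1 (X := X) 1)) (tT X * H 1)
  (tTn X 1) (H 1) (tT X * tT X) (tT X <* k 1) (k 1)) => //.
- by typ.
- have := changed_pullback 1 1 (id1 (X : K)); rewrite /= !comp1r rw1.
  set a := fun i => _; set b := fun i => _; suff -> : a = b by [].
  by apply/funext=> i; rewrite /a /b rw1 lw_vcomp //; ends.
- by rewrite src_lw src_tp.
- by rewrite src_lw src_tp.
- by typ.
Qed.

Lemma changedP : isTangent changed_data.
Proof.
have tk1 := tk 1; have t1 := typed_tpi1 X; have t2 := typed_tpi2 X.
have tk2 := tk 2.
have fib (i j : 'I_3) : fibred (H 2) (id1 (X : K)) (tpr X i \o k 2) (tpr X j \o k 2).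
  by apply: fibred_pre tk2; exact: fibred_tpr.
have tsp := s_typed A.
split=> /=; rewrite -?/(tT X) -?/(tp X) -?/(tz X) -?/(tl X) -?/(tc X).
- exact: p_typed A.
- exact: z_typed A.
- by typ.
- exact: l_typed A.
- exact: c_typed A.
- exact: changed_pullback.
- exact: pz A.
- by rewrite vcompA; [rewrite (ps A : _ = tp X \o tpi1 X); assocr | ends..].
- have f01 := fib o30 o31; have f12 := fib o31 o32.
  rewrite -/(tpi1 X) -/(tpi2 X).
  rewrite (changed_sum f01) (changed_sum f12) !(changed_sum (G := H 2)).
  + exact: gsum_assoc f01 f12.
  + split; [by case: f01 | exact: gsum_typed f12 |].
    by rewrite (gsum_p f12); case: f01.
  + split; [exact: gsum_typed f01 | by case: f12 |].
    by rewrite (gsum_p f01); case: (fib o30 o32).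
- have f01 := fibred_pre (fibred_tpr X o20 o21) tk1.
  have f10 := fibred_pre (fibred_tpr X o21 o20) tk1.
  rewrite -/(tpi1 X) -/(tpi2 X) (changed_sum f10) (gsum_comm f01).
  have := @gsum_pair _ X _ (id1 (X : K)) (H 1) (k 1).
  by rewrite !rw1 comp1r => ->.
- rewrite -/(tpi1 X) -/(tpi2 X) (changed_sum (G := tT X)).
    by rewrite gsum1; exact: (s_unit A).
  split; [typ|typ|].
  have pz' : tp X \o tz X = id2 (id1 (X : K)) := pz A.
  rewrite !rw1; tail pz'; rewrite (vcomp_idl (p_typed A)).
  by rewrite (vcomp_idr (p_typed A)).
- exact: Tp_l A.
- exact: l_z A.
- have pTl : tT X <* tp X \o tl X = tz X \o tp X := Tp_l A.
  rewrite !vcompA; try by ends.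
  rewrite changed_Tsum; [|typ|typ|].
    by rewrite (l_s A).
  tail pTl; tail pTl; assocr.
  by rewrite (tp_tpr X o20 o21).
- exact: pT_c A.
- exact: c_Tz A.
- rewrite !lw_vcomp; try by ends.
  rewrite !rw_vcomp; try by ends.
  rewrite !vcompA; try by ends.
  have pTc : tp X *> tT X \o tc X = tT X <* tp X := pT_c A.
  have := @pair_change _ _ _ _ _ _ (Tn_pullback0 (X := X) 1 (tT X)) (H 1 * tT X)
    (tT X * tTn X 1) (tT X * H 1) (tT X * tT X) (k 1 *> tT X) (tT X <* k 1)
    (ts X *> tT X) (tc X \o tT X <* tpi1 X) (tc X \o tT X <* tpi2 X).
  move=> -> //.
  + by rewrite (c_Ts A).
  + by typ.
  + have := changed_pullback 1 0 (tT X); rewrite /= !comp1l !lw1.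
    set a := fun i => _; set b := fun i => _; suff -> : a = b by [].
    by apply/funext=> i; rewrite /a /b lw1 rw_vcomp //; ends.
  + by rewrite src_rw src_tp; typ.
  + by rewrite src_rw src_tp; typ.
  + tail pTc; tail pTc; rewrite -!lw_vcomp; try by ends.
    by rewrite (tp_tpr X o20 o21).
  + by typ.
  + by typ.
- exact: Tl_l A.
- exact: c_l A.
- exact: c_Tc_l A.
- exact: c_c A.
- exact: Tc_c_Tc A.
- move=> Z F.
  have pTl : tT X <* tp X \o tl X = tz X \o tp X := Tp_l A.
  have pTz : tT X <* tp X \o tz X *> tT X = tz X \o tp X.
    have := whisk_exchange (p_typed A) (z_typed A).
    by rewrite rw1 lw1.
  have elz : tT X <* tp X \o (tl X \o tpi1 X) =
      tT X <* tp X \o (tz X *> tT X \o tpi2 X).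
    by tail pTl; tail pTz; assocr; rewrite (tp_tpr X o20 o21).
  have [||] := pair2P (pointwise_id (Tn_pullback1 (X := X) 1)) (f := tl X \o tpi1 X)
    (g := tz X *> tT X \o tpi2 X) (G := tTn X 1) _ _ elz; [typ|typ|].
  rewrite /= => tpair _ _ _.
  rewrite !vcompA; try by ends.
  rewrite changed_Tsum //; [|typ|typ].
  have L := lift_pullback A F; rewrite -/(tT X) in L *.
  rewrite [X in is_pullback2 _ X]rw_vcomp; [|ends].
  rewrite [X in is_pullback2 _ _ X]rw_vcomp; [|ends].
  have tk1' := tk' 1; have tkF := typed_rw F tk1; have tkF' := typed_rw F (tk' 1).
  apply: (pullback_iso L tkF tkF').
  + by rewrite -rw_vcomp ?kk' ?rw_id2 //; ends.
  + by rewrite -rw_vcomp ?k'k ?rw_id2 //; ends.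
Qed.

End ChangeOfPullbacks.

(** * Pullbacks in a 2-pullback *)

Section TwoPullback.
Variables (K : twoCat) (E B P : K) (n : nat).
Variables (pi : 'I_n.+1 -> mor P E) (U : mor E B).
Hypothesis HP : is_nfold_2pullback pi U.

Lemma twopb_eq i j : U * pi i = U * pi j.
Proof. by case: HP. Qed.

Lemma twopb_mor_inj (Z : K) (F G : mor Z P) :
  (forall k, pi k * F = pi k * G) -> F = G.
Proof.
move=> e; case: HP => eU univ _.
have [|H [_ uH]] := univ Z (fun k => pi k * F).
  by move=> i j; rewrite !comp1A (eU i j).
by rewrite -(uH F) // -(uH G).
Qed.

Lemma twopb_cell_inj (Z : K) (a b : cell Z P) :
  (forall k, pi k <* a = pi k <* b) -> a = b.
Proof.
move=> e; case: HP => eU _ univ.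
have [|c [_ uc]] := univ Z (fun k => pi k <* a).
  by move=> i j; rewrite !lw_lw (eU i j).
by rewrite -(uc a) // -(uc b).
Qed.

Lemma twopb_mor_lift (Z : K) (F : 'I_n.+1 -> mor Z E) :
  (forall i j, U * F i = U * F j) -> exists H, forall k, pi k * H = F k.
Proof. by move=> e; case: HP => _ /(_ Z F e)[H [eH _]] _; exists H. Qed.

Lemma twopb_cell_lift (Z : K) (a : 'I_n.+1 -> cell Z E) :
  (forall i j, U <* a i = U <* a j) -> exists b, forall k, pi k <* b = a k.
Proof. by move=> e; case: HP => _ _ /(_ Z a e)[b [eb _]]; exists b. Qed.

Lemma twopb_typed (Z : K) (F G : mor Z P) (a : cell Z P) :
  (forall k, typed (pi k <* a) (pi k * F) (pi k * G)) -> typed a F G.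
Proof.
move=> t; split; apply: twopb_mor_inj => k; case: (t k).
  by rewrite src_lw.
by rewrite tgt_lw.
Qed.

(** A pullback in a pullback of categories can be computed on the factors.  The
    base is needed to glue the mediating 2-morphisms h_k: their images under U
    agree because U sends the pullback in each factor to a pullback. *)
Lemma twopb_nfold (Z : K) m (Q : mor Z P) (rho : 'I_m.+1 -> cell Z P)
    (q : cell Z P) :
  (forall k, is_nfold_pullback2 (pi k * Q) (fun j => pi k <* rho j)
     (pi k <* q)) ->
  (forall k, is_nfold_pullback2 (U * (pi k * Q)) (fun j => U <* (pi k <* rho j))
     (U <* (pi k <* q))) ->
  is_nfold_pullback2 Q rho q.
Proof.
move=> HE HB.
have trho j : typed (rho j) Q (src q).
  apply: twopb_typed => k; rewrite -src_lw.
  exact: (nfold_typed (HE k) j).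
split=> //.
  move=> i j; apply: twopb_cell_inj => k.
  have ti := trho i; have tj := trho j.
  rewrite !lw_vcomp; try by ends.
  by case: (HE k) => _ /(_ i j).
move=> G f tf ef.
have ex k : exists2 h, typed h (pi k * G) (pi k * Q) &
    forall j, pi k <* rho j \o h = pi k <* f j.
  apply: (nfold_lift (HE k)) => [j|i j].
    by rewrite src_lw; apply: typed_lw.
  have ti := tf i; have tj := tf j.
  by rewrite -!lw_vcomp ?(ef i j) //; ends.
pose h k := s2val (cid2 (ex k)).
have th k : typed (h k) (pi k * G) (pi k * Q) by rewrite /h; case: cid2.
have eh k j : pi k <* rho j \o h k = pi k <* f j by rewrite /h; case: cid2.
have [|b eb] := @twopb_cell_lift Z h.
  move=> i j; apply: (nfold_inj (HB i) (G := U * (pi i * G))).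
  - exact: typed_lw.
  - by rewrite 2!comp1A (twopb_eq i j) -2!comp1A; apply: typed_lw.
  - move=> k; have thi := th i; have thj := th j; have trk := trho k.
    rewrite -lw_vcomp; last by ends.
    rewrite eh [U <* (pi i <* rho k)]lw_lw [U <* (pi i <* f k)]lw_lw (twopb_eq i j).
    rewrite -[RHS]/(_ \o _) -!lw_lw -lw_vcomp; last by ends.
    by rewrite eh.
have tb : typed b G Q by apply: twopb_typed => k; rewrite eb.
exists b; split=> [|b' [tb' eb']].
  split=> // j; have tj := trho j; apply: twopb_cell_inj => k.
  by rewrite lw_vcomp; [rewrite eb eh | ends].
apply: twopb_cell_inj => k; rewrite eb.
apply: (nfold_inj (HE k)) (th k) (typed_lw _ tb') _ => j; rewrite eh.
by have tj := trho j; rewrite -lw_vcomp ?eb' //; ends.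
Qed.

Lemma twopb_square (Z : K) (Q : mor Z P) (a b f g : cell Z P) :
  (forall k, is_pullback2 (pi k * Q) (pi k <* a) (pi k <* b)
     (pi k <* f) (pi k <* g)) ->
  (forall k, is_pullback2 (U * (pi k * Q)) (U <* (pi k <* a)) (U <* (pi k <* b))
     (U <* (pi k <* f)) (U <* (pi k <* g))) ->
  is_pullback2 Q a b f g.
Proof.
move=> HE HB.
have ta : typed a Q (src f).
  by apply: twopb_typed => k; rewrite -src_lw; case: (HE k).
have tb : typed b Q (src g).
  by apply: twopb_typed => k; rewrite -src_lw; case: (HE k).
have efg : tgt f = tgt g.
  by apply: twopb_mor_inj => k; rewrite -!tgt_lw; case: (HE k).
split=> //.
  apply: twopb_cell_inj => k.
  rewrite !lw_vcomp; try by ends.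
  by case: (HE k).
move=> G x y tx ty exy.
have ex k : exists h, [/\ typed h (pi k * G) (pi k * Q),
    pi k <* a \o h = pi k <* x & pi k <* b \o h = pi k <* y].
  case: (HE k) => _ _ _ _ /(_ (pi k * G) (pi k <* x) (pi k <* y))[].
  - by rewrite src_lw; apply: typed_lw.
  - by rewrite src_lw; apply: typed_lw.
  - by rewrite -!lw_vcomp ?exy //; ends.
  - by move=> h [? _]; exists h.
pose h k := projT1 (cid (ex k)).
have th k : [/\ typed (h k) (pi k * G) (pi k * Q),
    pi k <* a \o h k = pi k <* x & pi k <* b \o h k = pi k <* y].
  by rewrite /h; case: cid.
have [|c ec] := @twopb_cell_lift Z h.
  move=> i j; have [thi ai bi] := th i; have [thj aj bj] := th j.
  have e (d : cell Z P) : U <* (pi i <* d) = U <* (pi j <* d).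
    by rewrite !lw_lw (twopb_eq i j).
  apply: (pullback_inj (HB i) (G := U * (pi i * G))).
  - exact: typed_lw.
  - by rewrite 2!comp1A (twopb_eq i j) -2!comp1A; apply: typed_lw.
  - rewrite -lw_vcomp; last by ends.
    rewrite ai e [U <* (pi i <* a)]e -lw_vcomp; last by ends.
    by rewrite aj.
  - rewrite -lw_vcomp; last by ends.
    rewrite bi e [U <* (pi i <* b)]e -lw_vcomp; last by ends.
    by rewrite bj.
have tc : typed c G Q by apply: twopb_typed => k; rewrite ec; case: (th k).
exists c; split=> [|c' [tc' ac' bc']].
  split=> //; apply: twopb_cell_inj => k; have [_ ak bk] := th k;
    by rewrite lw_vcomp ?ec //; ends.
apply: twopb_cell_inj => k; rewrite ec; have [tk ak bk] := th k.
apply: (pullback_inj (HE k)) tk (typed_lw _ tc') _ _.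
  by rewrite ak -lw_vcomp ?ac' //; ends.
by rewrite bk -lw_vcomp ?bc' //; ends.
Qed.

End TwoPullback.

(** * Tangent structures on 2-pullbacks *)

(** Unlike a strict tangent morphism, F commutes with the chosen pullbacks T_n and
    their projections as well; this is what a componentwise definition needs. *)
Record preserves (K : twoCat) (X Y : K) (D : tangentData X) (D' : tangentData Y)
    (F : mor X Y) : Prop := Preserves {
  pres_T : F * dT D = dT D' * F;
  pres_Tn : forall n, F * dTn D n = dTn D' n * F;
  pres_pr : forall n (k : 'I_n.+1), F <* dpr D k = dpr D' k *> F;
  pres_p : F <* dp D = dp D' *> F;
  pres_z : F <* dz D = dz D' *> F;
  pres_s : F <* ds D = ds D' *> F;
  pres_l : F <* dl D = dl D' *> F;
  pres_c : F <* dc D = dc D' *> F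
}.

(** The pairs to which a pairing over q applies. *)
Definition matching (K : twoCat) (X Y : K) (q : cell X Y) (G : mor X Y)
    (f g : cell X Y) : Prop :=
  [/\ typed f G (src q), typed g G (src q) & q \o f = q \o g].

Lemma pair_typed (K : twoCat) (X Y : K) (P G : mor X Y)
    (pi : 'I_2 -> cell X Y) (q f g : cell X Y) :
  pointwise_nfold_pullback2 P pi q -> matching q G f g ->
  typed (pair2 (pi o20) (pi o21) f g) G P.
Proof. by move=> /pointwise_id HP [tf tg e]; have [] := pair2P HP tf tg e. Qed.

(** The part of the axioms that makes the pairings in the other axioms
    meaningful.  It is proved first on a 2-pullback, and then allows these pairings
    to be compared with those of the factors. *)
Record isPretangent (K : twoCat) (X : K) (D : tangentData X) : Prop :=
    IsPretangent {
  pre_p : typed (dp D) (dT D) (id1 X);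
  pre_z : typed (dz D) (id1 X) (dT D);
  pre_s : typed (ds D) (dTn D 1) (dT D);
  pre_l : typed (dl D) (dT D) (dT D * dT D);
  pre_c : typed (dc D) (dT D * dT D) (dT D * dT D);
  pre_pullback : forall n m,
    pointwise_nfold_pullback2 (iter1 (dT D) m * dTn D n)
      (fun k : 'I_n.+1 => iter1 (dT D) m <* dpr D k) (iter1 (dT D) m <* dp D);
  pre_pz : dp D \o dz D = id2 (id1 X);
  pre_ps : dp D \o ds D = dp D \o dpr D o20;
  pre_Tp_l : dT D <* dp D \o dl D = dz D \o dp D;
  pre_pT_c : dp D *> dT D \o dc D = dT D <* dp D
}.

Lemma tangent_pre (K : twoCat) (X : K) (D : tangentData X) :
  isTangent D -> isPretangent D.
Proof. by case. Qed.

Section Pretangent.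
Variables (K : twoCat) (X : K) (D : tangentData X).
Hypothesis A : isPretangent D.
Let T := dT D.
Let p := dp D.
Let z := dz D.
Let s := ds D.
Let l := dl D.
Let c := dc D.
Let tp : typed p T (id1 X) := pre_p A.
Let tz : typed z (id1 X) T := pre_z A.
Let ts : typed s (dTn D 1) T := pre_s A.
Let tl : typed l T (T * T) := pre_l A.
Let tc : typed c (T * T) (T * T) := pre_c A.

Lemma pre_pullback0 n :
  pointwise_nfold_pullback2 (dTn D n) (fun k : 'I_n.+1 => dpr D k) p.
Proof.
move=> Z F; have /= := pre_pullback A n 0 F; rewrite comp1l lw1.
by under eq_fun => k do rewrite lw1.
Qed.

Lemma pre_pullback_T n : pointwise_nfold_pullback2 (dTn D n * T)
  (fun k : 'I_n.+1 => dpr D k *> T) (p *> T).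
Proof.
move=> Z F; have := pre_pullback0 n (T * F); rewrite comp1A -rw_rw.
by under eq_fun => k do rewrite -rw_rw.
Qed.

Lemma pre_T_pullback n : pointwise_nfold_pullback2 (T * dTn D n)
  (fun k : 'I_n.+1 => T <* dpr D k) (T <* p).
Proof. by move=> Z F; have /= := pre_pullback A n 1 F; rewrite comp1r. Qed.

Lemma pre_pr n (k : 'I_n.+1) : typed (dpr D k) (dTn D n) T.
Proof.
by have := nfold_typed (pointwise_id (pre_pullback0 n)) k; rewrite (proj1 tp).
Qed.

Lemma pre_eq n (i j : 'I_n.+1) : p \o dpr D i = p \o dpr D j.
Proof. by case: (pointwise_id (pre_pullback0 n)). Qed.

Let psrc : src p = T := proj1 tp.

Lemma matching_pr n (i j : 'I_n.+1) : matching p (dTn D n) (dpr D i) (dpr D j).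
Proof.
split; rewrite ?psrc; [exact: pre_pr | exact: pre_pr | exact: pre_eq].
Qed.

Let pair f g := pair2 (dpr D o20) (dpr D o21) f g.

Lemma matching_pair G f g : matching p G f g ->
  typed (pair f g) G (dTn D 1) /\ dpr D o20 \o pair f g = f.
Proof.
by move=> [tf tg e]; have [t e0 _ _] := pair2P (pointwise_id (pre_pullback0 1)) tf tg e.
Qed.

Lemma matching_s G f g : matching p G f g ->
  typed (s \o pair f g) G T /\ p \o (s \o pair f g) = p \o f.
Proof.
move=> m; have [t e] := matching_pair m; split; first by typ.
have t0 := pre_pr o20.
by tail (pre_ps A); assocr; rewrite e.
Qed.

Lemma matching_assocl :
  matching p (dTn D 2) (s \o pair (dpr D o30) (dpr D o31)) (dpr D o32).
Proof.
have [t e] := matching_s (matching_pr o30 o31).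
by split; rewrite ?psrc ?e //; [exact: pre_pr | exact: pre_eq].
Qed.

Lemma matching_assocr :
  matching p (dTn D 2) (dpr D o30) (s \o pair (dpr D o31) (dpr D o32)).
Proof.
have [t e] := matching_s (matching_pr o31 o32).
by split; rewrite ?psrc ?e //; [exact: pre_pr | exact: pre_eq].
Qed.

Lemma matching_unit : matching p T (z \o p) (id2 T).
Proof.
split; rewrite ?psrc; [typ|typ|].
by tail (pre_pz A); rewrite (vcomp_idl tp) (vcomp_idr tp).
Qed.

Let t1 : typed (dpr D o20) (dTn D 1) T := pre_pr o20.
Let t2 : typed (dpr D o21) (dTn D 1) T := pre_pr o21.

Lemma matching_l :
  matching (T <* p) (dTn D 1) (l \o dpr D o20) (l \o dpr D o21).
Proof.
split; rewrite ?src_lw ?psrc; [typ|typ|].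
tail (pre_Tp_l A); tail (pre_Tp_l A); assocr.
by rewrite (pre_eq o20 o21).
Qed.

Lemma matching_lift :
  matching (T <* p) (dTn D 1) (l \o dpr D o20) (z *> T \o dpr D o21).
Proof.
split; rewrite ?src_lw ?psrc; [typ|typ|].
have pTz : T <* p \o z *> T = z \o p.
  by have := whisk_exchange tp tz; rewrite rw1 lw1.
tail (pre_Tp_l A); tail pTz; assocr.
by rewrite (pre_eq o20 o21).
Qed.

Lemma matching_c : matching (p *> T) (T * dTn D 1) (c \o T <* dpr D o20)
  (c \o T <* dpr D o21).
Proof.
split; rewrite ?src_rw ?psrc; [typ|typ|].
tail (pre_pT_c A); tail (pre_pT_c A); rewrite -!lw_vcomp; try by ends.
by rewrite (pre_eq o20 o21).
Qed.

End Pretangent.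

Section Over.
Variables (K : twoCat) (X Y : K) (F : mor X Y).

(** The axioms of a tangent structure are equations between 2-morphisms built from
    the structure; this relation, which all the constructions respect, carries
    such an equation from Y to X along a family of 1-morphisms F that is jointly
    faithful. *)
Definition covers (a : cell X X) (a' : cell Y Y) : Prop := F <* a = a' *> F.

Lemma covers_comp (a b : cell X X) (a' b' : cell Y Y) :
  tgt a = src b -> tgt a' = src b' -> covers b b' -> covers a a' ->
  covers (b \o a) (b' \o a').
Proof.
by move=> e e' ob oa; rewrite /covers lw_vcomp // rw_vcomp // ob oa.
Qed.

Lemma covers_lw (T : mor X X) (T' : mor Y Y) (a : cell X X) (a' : cell Y Y) :
  F * T = T' * F -> covers a a' -> covers (T <* a) (T' <* a').
Proof. by move=> e oa; rewrite /covers lw_lw e -lw_lw oa lw_rw. Qed.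

Lemma covers_rw (T : mor X X) (T' : mor Y Y) (a : cell X X) (a' : cell Y Y) :
  F * T = T' * F -> covers a a' -> covers (a *> T) (a' *> T').
Proof. by move=> e oa; rewrite /covers lw_rw oa !rw_rw e. Qed.

Lemma covers_id2 (T : mor X X) (T' : mor Y Y) :
  F * T = T' * F -> covers (id2 T) (id2 T').
Proof. by move=> e; rewrite /covers lw_id2 e rw_id2. Qed.

Lemma covers_pair (P : mor X X) (pi : 'I_2 -> cell X X) (q f g : cell X X)
    (P' : mor Y Y) (pi' : 'I_2 -> cell Y Y) (q' f' g' : cell Y Y)
    (G : mor X X) (G' : mor Y Y) :
  pointwise_nfold_pullback2 P pi q -> pointwise_nfold_pullback2 P' pi' q' ->
  matching q G f g -> matching q' G' f' g' ->
  F * P = P' * F -> F * G = G' * F ->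
  (forall i, covers (pi i) (pi' i)) -> covers f f' -> covers g g' ->
  covers (pair2 (pi o20) (pi o21) f g) (pair2 (pi' o20) (pi' o21) f' g').
Proof.
move=> /pointwise_id HP HP' [tf tg e] [tf' tg' e'] eP eG opi of_ og.
have HP1 := pointwise_id HP'.
have tpi := nfold_typed HP; have tpi' := nfold_typed HP1.
have [h [th ef eg]] := pair_lift HP tf tg e.
have [h' [th' ef' eg']] := pair_lift HP1 tf' tg' e'.
rewrite ef eg ef' eg' (pair_eta HP th) (pair_eta HP1 th').
apply: (nfold_inj (HP' _ F) (G := F * G)).
- by rewrite -eP; exact: typed_lw.
- by rewrite eG; exact: typed_rw.
suff : pi' o20 *> F \o F <* h = pi' o20 *> F \o h' *> F /\
       pi' o21 *> F \o F <* h = pi' o21 *> F \o h' *> F.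
  by move=> [e0 e1] [[|[|i]] li] //; rewrite (bool_irrelevance li isT).
have t0 := tpi o20; have t1 := tpi o21.
have t0' := tpi' o20; have t1' := tpi' o21.
split; rewrite -[RHS]rw_vcomp; try by ends.
  by rewrite -ef' -of_ ef lw_vcomp ?opi //; ends.
by rewrite -eg' -og eg lw_vcomp ?opi //; ends.
Qed.

End Over.

Ltac covers_step :=
  first [exact: pres_p | exact: pres_z | exact: pres_s | exact: pres_l
       | exact: pres_c | exact: pres_pr | exact: covers_id2 (pres_T _)
       | apply: covers_lw; first exact: pres_T
       | apply: covers_rw; first exact: pres_T
       | apply: covers_comp; [solve [ends] | solve [ends] | | ]].
Ltac covers_solve := repeat covers_step.

Section PreservesPairs.
Variables (K : twoCat) (X Y : K) (D : tangentData X) (D' : tangentData Y).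
Hypotheses (A : isPretangent D) (A' : isPretangent D').
Variable F : mor X Y.
Hypothesis pF : preserves D D' F.
Let T := dT D.
Let T' := dT D'.
Let tp := pre_p A.
Let tz := pre_z A.
Let ts := pre_s A.
Let tl := pre_l A.
Let tp' := pre_p A'.
Let tz' := pre_z A'.
Let ts' := pre_s A'.
Let tl' := pre_l A'.

Lemma pres_TTn n : F * (T * dTn D n) = T' * dTn D' n * F.
Proof. by rewrite comp1A (pres_T pF) -comp1A (pres_Tn pF) comp1A. Qed.

Lemma covers_pair0 G G' f g f' g' : matching (dp D) G f g ->
  matching (dp D') G' f' g' -> F * G = G' * F ->
  covers F f f' -> covers F g g' ->
  covers F (pair2 (dpr D o20) (dpr D o21) f g)
         (pair2 (dpr D' o20) (dpr D' o21) f' g').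
Proof.
move=> m m' eG of_ og.
apply: (covers_pair (pre_pullback0 A 1) (pre_pullback0 A' 1) m m') => //.
  exact: pres_Tn.
by move=> i; exact: pres_pr.
Qed.

Lemma covers_pairT f g f' g' : matching (T <* dp D) (dTn D 1) f g ->
  matching (T' <* dp D') (dTn D' 1) f' g' ->
  covers F f f' -> covers F g g' ->
  covers F (pair2 (T <* dpr D o20) (T <* dpr D o21) f g)
         (pair2 (T' <* dpr D' o20) (T' <* dpr D' o21) f' g').
Proof.
move=> m m' of_ og.
apply: (covers_pair (pre_T_pullback A 1) (pre_T_pullback A' 1) m m') => //.
- exact: pres_TTn.
- exact: pres_Tn.
- by move=> i; covers_solve.
Qed.

Lemma covers_Tpair f g f' g' : matching (dp D *> T) (T * dTn D 1) f g ->
  matching (dp D' *> T') (T' * dTn D' 1) f' g' ->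
  covers F f f' -> covers F g g' ->
  covers F (pair2 (dpr D o20 *> T) (dpr D o21 *> T) f g)
         (pair2 (dpr D' o20 *> T') (dpr D' o21 *> T') f' g').
Proof.
move=> m m' of_ og.
apply: (covers_pair (pre_pullback_T A 1) (pre_pullback_T A' 1) m m') => //.
- by rewrite comp1A (pres_Tn pF) -comp1A (pres_T pF) comp1A.
- exact: pres_TTn.
- by move=> i; covers_solve.
Qed.

Lemma covers_lift : covers F
  (T <* ds D \o pair2 (T <* dpr D o20) (T <* dpr D o21)
    (dl D \o dpr D o20) (dz D *> T \o dpr D o21))
  (T' <* ds D' \o pair2 (T' <* dpr D' o20) (T' <* dpr D' o21)
    (dl D' \o dpr D' o20) (dz D' *> T' \o dpr D' o21)).
Proof.
have t1 := pre_pr A o20; have t1' := pre_pr A' o20.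
have t2 := pre_pr A o21; have t2' := pre_pr A' o21.
have mf := matching_lift A; have mf' := matching_lift A'.
have tpf := pair_typed (pre_T_pullback A 1) mf.
have tpf' := pair_typed (pre_T_pullback A' 1) mf'.
by covers_solve; apply: covers_pairT => //; covers_solve.
Qed.

End PreservesPairs.

Section TangentTwoPullback.
Variables (K : twoCat) (E B P : K) (n : nat).
Variables (pi : 'I_n.+1 -> mor P E) (U : mor E B).
Hypothesis HP : is_nfold_2pullback pi U.
Variables (DE : tangentData E) (DB : tangentData B) (D : tangentData P).
Hypotheses (TE : isTangent DE) (TB : isTangent DB).
Hypothesis presU : preserves DE DB U.
Hypothesis prespi : forall k, preserves D DE (pi k).

Lemma covers_inj (a b : cell P P) (a' b' : cell E E) :
  (forall k, covers (pi k) a a') -> (forall k, covers (pi k) b b') -> a' = b' ->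
  a = b.
Proof.
by move=> oa ob e; apply: (twopb_cell_inj HP) => k; rewrite oa ob e.
Qed.

Lemma covers_typed (a : cell P P) (F G : mor P P) (a' : cell E E)
    (F' G' : mor E E) :
  (forall k, covers (pi k) a a') -> (forall k, pi k * F = F' * pi k) ->
  (forall k, pi k * G = G' * pi k) -> typed a' F' G' -> typed a F G.
Proof.
move=> oa eF eG ta; apply: (twopb_typed HP) => k.
by rewrite oa eF eG; apply: typed_rw.
Qed.

Lemma pres_iter (X Y : K) (D1 : tangentData X) (D2 : tangentData Y) F m :
  preserves D1 D2 F -> F * iter1 (dT D1) m = iter1 (dT D2) m * F.
Proof.
move=> pF; elim: m => [|m IH] /=; first by rewrite comp1r comp1l.
by rewrite comp1A (pres_T pF) -comp1A IH comp1A.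
Qed.

Let T := dT D.
Let T' := dT DE.

Lemma twopb_p_typed : typed (dp D) T (id1 P).
Proof.
apply: covers_typed (p_typed TE) => k; first exact: pres_p.
  exact: pres_T. by rewrite comp1l comp1r.
Qed.
Lemma twopb_z_typed : typed (dz D) (id1 P) T.
Proof.
apply: covers_typed (z_typed TE) => k; first exact: pres_z.
  by rewrite comp1l comp1r. exact: pres_T.
Qed.
Lemma twopb_s_typed : typed (ds D) (dTn D 1) T.
Proof.
apply: covers_typed (s_typed TE) => k; first exact: pres_s.
  exact: pres_Tn. exact: pres_T.
Qed.
Lemma pres_TT k : pi k * (T * T) = T' * T' * pi k.
Proof. by rewrite comp1A (pres_T (prespi k)) -comp1A (pres_T (prespi k)) comp1A. Qed.
Lemma twopb_l_typed : typed (dl D) T (T * T).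
Proof.
apply: covers_typed (l_typed TE) => k; first exact: pres_l.
  exact: pres_T. exact: pres_TT.
Qed.
Lemma twopb_c_typed : typed (dc D) (T * T) (T * T).
Proof.
apply: covers_typed (c_typed TE) => k; first exact: pres_c.
  exact: pres_TT. exact: pres_TT.
Qed.

Lemma twopb_Tn m j : pointwise_nfold_pullback2 (iter1 T j * dTn D m)
  (fun k : 'I_m.+1 => iter1 T j <* dpr D k) (iter1 T j <* dp D).
Proof.
move=> Z F.
have e1 k : pi k * (iter1 T j * dTn D m * F) = iter1 T' j * dTn DE m * (pi k * F).
  rewrite !comp1A (pres_iter _ (prespi k)) -[_ * pi k * _]comp1A.
  by rewrite (pres_Tn (prespi k)) !comp1A.
have e2 k (a : cell P P) a' : covers (pi k) a a' ->
    pi k <* ((iter1 T j <* a) *> F) = (iter1 T' j <* a') *> (pi k * F).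
  by move=> oa; rewrite lw_rw (covers_lw (pres_iter j (prespi k)) oa) rw_rw.
have e3 k (a : cell P P) a' a'' : covers (pi k) a a' -> covers U a' a'' ->
    U <* (pi k <* ((iter1 T j <* a) *> F)) = (iter1 (dT DB) j <* a'') *> (U * (pi k * F)).
  by move=> oa oa'; rewrite (e2 _ _ _ oa) lw_rw (covers_lw (pres_iter j presU) oa') rw_rw.
apply: (twopb_nfold HP) => k.
  have := Tn_pullback TE m j (pi k * F); rewrite e1 (e2 _ _ _ (pres_p (prespi k))).
  set f := fun i => _; set g := fun i => _; suff -> : f = g by [].
  by apply/funext => i; rewrite /f /g (e2 _ _ _ (pres_pr (prespi k) i)).
have := Tn_pullback TB m j (U * (pi k * F)).
rewrite e1 (e3 _ _ _ _ (pres_p (prespi k)) (pres_p presU)).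
have -> : U * (iter1 T' j * dTn DE m * (pi k * F)) =
    iter1 (dT DB) j * dTn DB m * (U * (pi k * F)).
  by rewrite !comp1A (pres_iter _ presU) -[_ * U * _]comp1A (pres_Tn presU) !comp1A.
set f := fun i => _; set g := fun i => _; suff -> : f = g by [].
by apply/funext => i; rewrite /f /g (e3 _ _ _ _ (pres_pr (prespi k) i) (pres_pr presU i)).
Qed.

Let A' := tangent_pre TE.
Let tp := twopb_p_typed.
Let tz := twopb_z_typed.
Let ts := twopb_s_typed.
Let tl := twopb_l_typed.
Let tc := twopb_c_typed.
Let tp' := pre_p A'.
Let tz' := pre_z A'.
Let ts' := pre_s A'.
Let tl' := pre_l A'.
Let tc' := pre_c A'.

Lemma twopb_pretangent : isPretangent D.
Proof.
have t1 : typed (dpr D o20) (dTn D 1) T.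
  have := nfold_typed (twopb_Tn 1 0 (id1 P)) o20; rewrite /= !rw1 !lw1 comp1r comp1l.
  by rewrite (proj1 tp).
have t1' := pre_pr A' o20.
split=> //; first exact: twopb_Tn.
- apply: (covers_inj _ _ (pz TE)) => k; covers_solve.
  by apply: covers_id2; rewrite comp1l comp1r.
- by apply: (covers_inj _ _ (ps TE)) => k; covers_solve.
- by apply: (covers_inj _ _ (Tp_l TE)) => k; covers_solve.
- by apply: (covers_inj _ _ (pT_c TE)) => k; covers_solve.
Qed.

(** The projections of P are jointly faithful and cover the equations of E; the
    universality of the lift is inherited by [twopb_square]. *)
Lemma twopb_tangent : isTangent D.
Proof.
have A := twopb_pretangent.
have o0 := pre_pullback0 A 1; have o0' := pre_pullback0 A' 1.
have t1 := pre_pr A o20; have t1' := pre_pr A' o20.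
have t2 := pre_pr A o21; have t2' := pre_pr A' o21.
have ml := matching_l A; have ml' := matching_l A'.
have mc := matching_c A; have mc' := matching_c A'.
have tpl := pair_typed (pre_T_pullback A 1) ml.
have tpl' := pair_typed (pre_T_pullback A' 1) ml'.
have tpc := pair_typed (pre_pullback_T A 1) mc.
have tpc' := pair_typed (pre_pullback_T A' 1) mc'.
split=> //; try by [case: A].
- have m01 := matching_pr A o30 o31; have m12 := matching_pr A o31 o32.
  have m01' := matching_pr A' o30 o31; have m12' := matching_pr A' o31 o32.
  have ml3 := matching_assocl A; have mr3 := matching_assocr A.
  have ml3' := matching_assocl A'; have mr3' := matching_assocr A'.
  have u1 := pair_typed o0 m01; have u2 := pair_typed o0 m12.
  have u3 := pair_typed o0 ml3; have u4 := pair_typed o0 mr3.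
  have u1' := pair_typed o0' m01'; have u2' := pair_typed o0' m12'.
  have u3' := pair_typed o0' ml3'; have u4' := pair_typed o0' mr3'.
  have e3 k : pi k * dTn D 2 = dTn DE 2 * pi k by exact: pres_Tn.
  apply: (covers_inj _ _ (s_assoc TE)) => k; covers_solve.
  + apply: (covers_pair0 A A' (prespi k) ml3 ml3') => //; covers_solve.
    by apply: (covers_pair0 A A' (prespi k) m01 m01') => //; covers_solve.
  + apply: (covers_pair0 A A' (prespi k) mr3 mr3') => //; covers_solve.
    by apply: (covers_pair0 A A' (prespi k) m12 m12') => //; covers_solve.
- have m10 := matching_pr A o21 o20; have m10' := matching_pr A' o21 o20.
  have u := pair_typed o0 m10; have u' := pair_typed o0' m10'.
  apply: (covers_inj _ _ (s_comm TE)) => k; covers_solve.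
  apply: (covers_pair0 A A' (prespi k) m10 m10') => //; covers_solve; exact: pres_Tn.
- have mu := matching_unit A; have mu' := matching_unit A'.
  have u := pair_typed o0 mu; have u' := pair_typed o0' mu'.
  apply: (covers_inj _ _ (s_unit TE)) => k; covers_solve.
  apply: (covers_pair0 A A' (prespi k) mu mu') => //; covers_solve; exact: pres_T.
- by apply: (covers_inj _ _ (l_z TE)) => k; covers_solve.
- apply: (covers_inj _ _ (l_s TE)) => k; covers_solve.
  by apply: (covers_pairT A A' (prespi k)) => //; covers_solve.
- by apply: (covers_inj _ _ (c_Tz TE)) => k; covers_solve.
- apply: (covers_inj _ _ (c_Ts TE)) => k; covers_solve.
  by apply: (covers_Tpair A A' (prespi k)) => //; covers_solve.
- by apply: (covers_inj _ _ (Tl_l TE)) => k; covers_solve.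
- by apply: (covers_inj _ _ (c_l TE)) => k; covers_solve.
- by apply: (covers_inj _ _ (c_Tc_l TE)) => k; covers_solve.
- apply: (covers_inj _ _ (c_c TE)) => k; covers_solve.
  by apply: covers_id2; exact: pres_TT.
- by apply: (covers_inj _ _ (Tc_c_Tc TE)) => k; covers_solve.
- move=> Z F.
  set a := _ \o pair2 _ _ _ _.
  apply: (twopb_square HP) => k.
  + have := lift_pullback TE (pi k * F).
    rewrite comp1A -(pres_Tn (prespi k)) -comp1A.
    have e (b : cell P P) b' : covers (pi k) b b' ->
        b' *> (pi k * F) = pi k <* (b *> F).
      by move=> ob; rewrite lw_rw ob rw_rw.
    rewrite (e _ _ (covers_lift A A' (prespi k))) (e _ _ (pres_z (prespi k))).
    rewrite (e (T <* dp D) (T' <* dp DE)); last by covers_solve.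
    rewrite (e (dp D \o dpr D o20) (dp DE \o dpr DE o20)); last by covers_solve.
    by [].
  + have := lift_pullback TB (U * (pi k * F)).
    rewrite comp1A -(pres_Tn presU) -comp1A [X in is_pullback2 (U * X)]comp1A.
    rewrite -(pres_Tn (prespi k)) -[X in is_pullback2 (U * X)]comp1A.
    have e (b : cell P P) b' b'' : covers (pi k) b b' -> covers U b' b'' ->
        b'' *> (U * (pi k * F)) = U <* (pi k <* (b *> F)).
      by move=> ob ob'; rewrite lw_rw ob rw_rw lw_rw ob' rw_rw.
    have AB := tangent_pre TB.
    have u1 := pre_pr AB o20; have tpB := pre_p AB.
    rewrite (e _ _ _ (covers_lift A A' (prespi k)) (covers_lift A' AB presU)).
    rewrite (e _ _ _ (pres_z (prespi k)) (pres_z presU)).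
    rewrite (e (T <* dp D) (T' <* dp DE) (dT DB <* dp DB)); try by covers_solve.
    rewrite (e (dp D \o dpr D o20) (dp DE \o dpr DE o20) (dp DB \o dpr DB o20));
      by covers_solve.
Qed.
End TangentTwoPullback.

(** * Componentwise structure and tangent pullbacks *)

Section ExistsData.
Variables (K : twoCat) (E B P : K) (n : nat).
Variables (pi : 'I_n.+1 -> mor P E) (U : mor E B).
Hypothesis HP : is_nfold_2pullback pi U.

Lemma twopb_endo (F : mor E E) (F' : mor B B) : U * F = F' * U ->
  exists G : mor P P, forall k, pi k * G = F * pi k.
Proof.
move=> e; apply: (twopb_mor_lift HP (F := fun k => F * pi k)) => i j.
by rewrite !comp1A e -!comp1A (twopb_eq HP i j).
Qed.

(** The family a_(pi k) agrees after U because U a = a'_U and the U pi_k coincide. *)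
Lemma twopb_endocell (a : cell E E) (a' : cell B B) : covers U a a' ->
  exists b : cell P P, forall k, covers (pi k) b a.
Proof.
move=> e; apply: (twopb_cell_lift HP (a := fun k => a *> pi k)) => i j.
by rewrite !lw_rw e !rw_rw (twopb_eq HP i j).
Qed.

Lemma twopb_data (DE : tangentData E) (DB : tangentData B) :
  preserves DE DB U ->
  exists D : tangentData P, forall k, preserves D DE (pi k).
Proof.
move=> pU.
have [T eT] := twopb_endo (pres_T pU).
have [Tn eTn] := choice (fun m => twopb_endo (pres_Tn pU m)).
have [pr epr] : exists pr : forall m, 'I_m.+1 -> cell P P,
    forall m i k, covers (pi k) (pr m i) (dpr DE i).
  pose prm m := choice (fun i : 'I_m.+1 => twopb_endocell (pres_pr pU i)).
  by exists (fun m => projT1 (prm m)) => m; case: (prm m).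
have [p ep] := twopb_endocell (pres_p pU).
have [z ez] := twopb_endocell (pres_z pU).
have [s es] := twopb_endocell (pres_s pU).
have [l el] := twopb_endocell (pres_l pU).
have [c ec] := twopb_endocell (pres_c pU).
exists (@TangentData K P T Tn pr p z s l c) => k.
by split=> //= *; [exact: epr | exact: ep | exact: ez | exact: es | exact: el | exact: ec].
Qed.

End ExistsData.

Section StrictOfCells.
Variables (K : twoCat) (X Y : tangentad K) (F : mor X Y).
Hypothesis eT : F * tT X = tT Y * F.
Hypothesis ep : F <* tp X = tp Y *> F.
Hypothesis ez : F <* tz X = tz Y *> F.
Hypothesis es : F <* ts X = gsum F (F <* tpi1 X) (F <* tpi2 X).
Hypothesis el : F <* tl X = tl Y *> F.
Hypothesis ec : F <* tc X = tc Y *> F.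

(** Compatibility with s is asked on the chosen pairing of the target, so that F
    need not commute with the chosen pullbacks of X and Y. *)
Lemma isLax_of_cells : isLax F (id2 (F * tT X)).
Proof.
have t1 := typed_tpi1 X; have t2 := typed_tpi2 X.
have ed : tT Y <* id2 (F * tT X) \o id2 (F * tT X) *> tT X = id2 (F * tT X * tT X).
  by rewrite lw_id2 rw_id2 comp1A -eT vcomp_id2.
have idl (a : cell X Y) G : typed a G (F * tT X) -> id2 (F * tT X) \o a = a.
  exact: vcomp_idl.
split.
- by rewrite -eT; exact: typed_id2.
- rewrite -ep (vcomp_idr (G := F)) //; typ.
- by rewrite (idl _ F) ?ez //; typ.
- rewrite !(idl _ (F * tTn X 1)) //; typ.
- rewrite ed -el (vcomp_idr (G := F * tT X * tT X)) //; last by typ.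
  by rewrite (vcomp_idl (F := F * tT X)) //; typ.
- rewrite -vcompA ?ed; [|by ends; rewrite -eT
    |by rewrite tgt_lw tgt_id2 src_rw src_tc eT comp1A].
  rewrite -ec (vcomp_idr (G := F * tT X * tT X)) //; last by typ.
  by rewrite (vcomp_idl (F := F * tT X * tT X)) //; typ.
Qed.

End StrictOfCells.

Section TangentPullback.
Variables (K : twoCat) (E B P : tangentad K) (n : nat).
Variables (pi : 'I_n.+1 -> strict P E) (U : strict E B).
Hypothesis HP : is_nfold_2pullback (fun k => lmor (pi k)) U.

Let mor_inj := twopb_mor_inj HP.
Let cell_inj := twopb_cell_inj HP.

Lemma lcell_comp_strict (X Y Z : tangentad K) (G : strict Y Z) (H : lax X Y) :
  lcell (lax_comp G H) = G <* lcell H.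
Proof.
have sG := strictP G.
by rewrite /= /lax_comp_cell strict_lcell_rw //; ends; rewrite -?comp1A ?(strict_T sG).
Qed.

Lemma twopb_lax (Z : tangentad K) (F : 'I_n.+1 -> lax Z E) (H : mor Z P)
    (a : cell Z P) :
  (forall k, pi k * H = F k) -> (forall k, pi k <* a = lcell (F k)) ->
  isLax H a.
Proof.
move=> eH ea.
have ePT k := strict_T (strictP (pi k)).
have ta : typed a (H * tT Z) (tT P * H).
  apply: (twopb_typed HP) => k; rewrite ea !comp1A -(ePT k) -[_ * pi k * _]comp1A eH.
  exact: lax_typed (laxP (F k)).
have whisk_r k (b : cell P P) (b' : cell E E) : pi k <* b = b' *> pi k ->
    pi k <* (b *> H) = b' *> F k.
  by move=> e; rewrite lw_rw e rw_rw eH.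
have eT k : pi k <* (tT P <* a) = tT E <* lcell (F k).
  by rewrite lw_lw -ePT -lw_lw ea.
have eTT k : pi k <* (tT P <* a \o a *> tT Z) =
    tT E <* lcell (F k) \o lcell (F k) *> tT Z.
  by rewrite lw_vcomp; [rewrite eT lw_rw ea | ends].
have el k (b : cell Z Z) : pi k <* (H <* b) = F k <* b by rewrite lw_lw eH.
have t1 := typed_tpi1 Z; have t2 := typed_tpi2 Z.
have ep : tp P *> H \o a = H <* tp Z.
  apply: cell_inj => k; rewrite el lw_vcomp; last by ends.
  rewrite (whisk_r _ _ _ (strict_p (strictP (pi k)))) ea.
  exact: lax_p (laxP (F k)).
split=> //.
- apply: cell_inj => k; rewrite lw_vcomp; last by ends.
  rewrite (whisk_r _ _ _ (strict_z (strictP (pi k)))) ea el.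
  exact: lax_z (laxP (F k)).
- have fib : fibred (H * tTn Z 1) H (a \o H <* tpi1 Z) (a \o H <* tpi2 Z).
    split; [typ|typ|]; tail ep; tail ep; rewrite -!lw_vcomp; try by ends.
    by rewrite (tp_tpr Z o20 o21).
  apply: cell_inj => k; rewrite -/(gsum H _ _) (strict_gsum (strictP (pi k)) fib).
  rewrite !lw_vcomp; try by ends.
  rewrite !el ea eH; exact: lax_s (laxP (F k)).
- apply: cell_inj => k; rewrite lw_vcomp; last by ends.
  rewrite [in RHS]lw_vcomp; last by ends.
  rewrite (whisk_r _ _ _ (strict_l (strictP (pi k)))) ea el eTT.
  exact: lax_l (laxP (F k)).
- apply: cell_inj => k; rewrite -[in LHS]vcompA; try by ends.
  rewrite lw_vcomp; last by ends.
  rewrite [in RHS]lw_vcomp; last by ends.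
  rewrite (whisk_r _ _ _ (strict_c (strictP (pi k)))) el eTT vcompA; try by ends.
  exact: lax_c (laxP (F k)).
Qed.

Lemma twopb_lax_inj (Z : tangentad K) (G H : lax Z P) :
  (forall k, lax_comp (pi k) G = lax_comp (pi k) H) -> G = H.
Proof.
move=> e; apply: lax_eq.
  by apply: mor_inj => k; exact: (congr1 (@lmor _ _ _) (e k)).
by apply: cell_inj => k; rewrite -!lcell_comp_strict e.
Qed.

Lemma twopb_strict (Z : tangentad K) (H : lax Z P) :
  (forall k, is_strict (lax_comp (pi k) H)) -> is_strict H.
Proof.
move=> e; apply: cell_inj => k; rewrite -lcell_comp_strict e lw_id2 /=.
by rewrite comp1A.
Qed.

(** The structure cell and the axioms of a tangent morphism into P are determined
    by, and can be checked on, the components, because the projections are strict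
    and jointly faithful. *)
Lemma strict_2pullback : is_nfold_2pullback_Tng (fun k => slax (pi k)) U.
Proof.
have eU i j : lax_comp U (pi i) = lax_comp U (pi j).
  apply: lax_eq; first exact: (twopb_eq HP).
  by rewrite !lcell_comp_strict !strictP !lw_id2 !comp1A (twopb_eq HP i j).
split=> //.
- move=> Z F eF.
  have [|H eH] := twopb_mor_lift HP (F := fun k => F k : mor Z E).
    by move=> i j; exact: (congr1 (@lmor _ _ _) (eF i j)).
  have [|a ea] := twopb_cell_lift HP (a := fun k => lcell (F k)).
    by move=> i j; rewrite -!lcell_comp_strict (eF i j).
  exists (Lax (twopb_lax eH ea)); split=> [k|G eG].
    by apply: lax_eq; rewrite ?lcell_comp_strict //= ?eH ?ea.
  apply: twopb_lax_inj => k; rewrite eG.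
  by apply: lax_eq; rewrite ?lcell_comp_strict //= ?eH ?ea.
- move=> Z F G a ta eUa.
  have [b eb] := twopb_cell_lift HP eUa.
  exists b; split=> [|b' [_ eb']]; last by apply: cell_inj => k; rewrite eb eb'.
  split=> //; split.
    by apply: (twopb_typed HP) => k; rewrite eb; case: (ta k).
  have tb : typed b F G.
    by apply: (twopb_typed HP) => k; rewrite eb; case: (ta k).
  apply: cell_inj => k; have [_ e] := ta k.
  rewrite !lw_vcomp; try by ends.
  rewrite lw_lw -(strict_T (strictP (pi k))) -lw_lw eb lw_rw eb.
  by rewrite -!lcell_comp_strict.
Qed.

End TangentPullback.

(** * Sums of vector fields and the additive bundle *)

Section SumField.
Variables (K : twoCat) (Z X : tangentad K) (F : lax Z X).

(** T is a tangent morphism with structure cell c, so it preserves sums up to c; the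
    two occurrences of c cancel because c is an involution. *)
Lemma tangent2_gsum (a b : cell Z X) :
  is_tangent2 F (lax_comp (lax_T X) F) a ->
  is_tangent2 F (lax_comp (lax_T X) F) b ->
  tp X *> F \o a = tp X *> F \o b ->
  is_tangent2 F (lax_comp (lax_T X) F) (gsum F a b).
Proof.
move=> [ta ea] [tb eb] e.
have fib : fibred F F a b by [].
have tg := gsum_typed fib.
split=> //; rewrite /= /lax_comp_cell /= in ea eb *.
have cc : tc X *> F \o tc X *> F = id2 (tT X * tT X * F).
  by rewrite -rw_vcomp; [rewrite (c_c (tangentP (tstruct X))) rw_id2 | ends].
have fibT := fibred_rw (tT Z) fib.
have E (c : cell Z X) : typed c F (tT X * F) ->
   tT X <* c \o lcell F = tc X *> F \o tT X <* lcell F \o c *> tT Z ->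
   tc X *> F \o tT X <* c \o lcell F = tT X <* lcell F \o c *> tT Z.
  move=> tc' ec; rewrite -vcompA; try by ends.
  rewrite ec vcompA; try by ends.
  rewrite vcompA; try by ends.
  by rewrite cc (vcomp_idl (F := tT X * (F * tT Z))) //; typ.
have L := lax_gsum (lax_T X) fib; rewrite /= in L.
have fibL := fibred_lax (lax_T X) fib; rewrite /= in fibL.
have tl' : typed (lcell F) (F * tT Z) (tT X * F) by typ.
have R : tT X <* lcell F \o gsum F a b *> tT Z =
    tc X *> F \o tT X <* gsum F a b \o lcell F.
  rewrite (gsum_rw (tT Z) fib) (gsum_nat tl' fibT) -(E a) // -(E b) //.
  by rewrite -(gsum_pre fibL tl') L.
rewrite -[RHS]vcompA; try by ends.
rewrite R !vcompA; try by ends.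
by rewrite cc (vcomp_idl (F := tT X * F)) //; typ.
Qed.

End SumField.

Section VectorFieldArithmetic.
Variables (K : twoCat) (X : tangentad K) (C : vfConstruction X).
Let V : tangentad K := VF C.
Let U : strict V X := VFU C.
Let v : cell V X := ucell C.
Let tv : typed v U (tT X * U). Proof. exact: ucell_typed. Qed.

Lemma VF_lift_strict (W : tangentad K) (F : strict W X) (w : cell W X) :
  is_tangent2 F (lax_comp (lax_T X) F) w -> tp X *> F \o w = id2 F ->
  exists H : strict W V, lax_comp U H = F /\ v *> H = w.
Proof.
move=> tw pw; have [H [eU ev]] := VF_mor_lift C tw pw.
have sH : is_strict H.
  by apply: (VF_strict_reflect (C := C)); rewrite eU; exact: strictP.
by exists (Strict sH).
Qed.

Lemma VF_strict_inj (W : tangentad K) (H G : strict W V) :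
  U * H = U * G -> v *> H = v *> G -> H = G.
Proof.
move=> eU ev; apply: strict_eq; congr lmor.
apply: (VF_mor_inj (C := C)) ev.
exact: (congr1 (@slax _ _ _) (strict_eq (F := strict_comp U H) (G := strict_comp U G) eU)).
Qed.

Lemma ucell_p_rw (W : tangentad K) (L : mor W V) :
  tp X *> (U * L) \o v *> L = id2 (U * L).
Proof. by rewrite -rw_rw -rw_vcomp; [rewrite ucell_p rw_id2 | ends]. Qed.

Lemma fields_fibred (W : tangentad K) (H G : mor W V) : U * G = U * H ->
  fibred (U * H) (U * H) (v *> H) (v *> G).
Proof.
move=> e; split; [typ|by rewrite -e; typ|].
by rewrite ucell_p_rw -e ucell_p_rw.
Qed.

Lemma zero_exists : exists Z : strict X V,
  Gamma (VFv C) X Z = vf_zero X /\ U * Z = id1 (X : K) /\ v *> Z = tz X.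
Proof.
have [||Z [eU ev]] := @VF_lift_strict X (strict_id X) (tz X).
- exact: zero_field_subproof.
- by rewrite rw1; exact: (pz (tangentP (tstruct X))).
exists Z; split; last by split=> //; exact: (congr1 (@lmor _ _ _) eU).
exact: vfObj_eq.
Qed.

Lemma sum_exists (W : tangentad K) (H G : strict W V) : U * G = U * H ->
  exists S : strict W V, [/\ is_vf_sum (Gamma (VFv C) W H) (Gamma (VFv C) W G)
    (Gamma (VFv C) W S), U * S = U * H
    & v *> S = gsum (U * H) (v *> H) (v *> G)].
Proof.
move=> e; have fib := fields_fibred e.
have eL : lax_comp U G = lax_comp U H.
  exact: (congr1 (@slax _ _ _) (strict_eq (F := strict_comp U G) (G := strict_comp U H) e)).
have tH (L : lax W V) : is_tangent2 (lax_comp U L)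
    (lax_comp (lax_T X) (lax_comp U L)) (v *> L).
  exact: Gamma_field_subproof.
have [||S [eS ev]] := @VF_lift_strict W (strict_comp U H) (gsum (U * H) (v *> H) (v *> G)).
- apply: tangent2_gsum => //; [exact: tH | by have := tH G; rewrite eL | by case: fib].
- by rewrite /= (gsum_p fib) ucell_p_rw.
exists S; split=> //; last exact: (congr1 (@lmor _ _ _) eS).
Qed.

(** The choice of pullbacks H_n for V, for which U preserves everything strictly. *)
Lemma VF_changed : exists (H : nat -> mor V V) (k : nat -> cell V V),
  [/\ forall n, typed (k n) (H n) (tTn V n), isTangent (changed_data H k)
    & preserves (changed_data H k) (tstruct X) U].
Proof.
have sU : is_strict U := strictP U.
have ex n : exists x : mor V V * cell V V * cell V V,
  [/\ typed x.1.2 x.1.1 (tTn V n), typed x.2 (tTn V n) x.1.1,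
      x.1.2 \o x.2 = id2 (tTn V n), x.2 \o x.1.2 = id2 x.1.1
    & U * x.1.1 = tTn X n * U /\
      forall i : 'I_n.+1, U <* (tpr V i \o x.1.2) = tpr X i *> U].
  by have [H [k [k' HH]]] := VF_Tn_iso C n; exists (H, k, k').
have [x Px] := choice ex.
exists (fun n => (x n).1.1), (fun n => (x n).1.2); split.
- by move=> n; case: (Px n).
- by apply: (changedP (k' := fun n => (x n).2)) => n; case: (Px n).
- split=> /=.
  + by rewrite (strict_T sU).
  + by move=> n; case: (Px n) => _ _ _ _ [].
  + by move=> n i; case: (Px n) => _ _ _ _ [].
  + exact: strict_p.
  + exact: strict_z.
  + have [tk _ _ _ [eH e]] := Px 1.
    have fib := fibred_tpr V o20 o21.
    have tUk : typed (U <* (x 1).1.2) (U * (x 1).1.1) (U * tTn V 1) by typ.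
    have es : ts V = gsum (id1 (V : K)) (tpi1 V) (tpi2 V).
      have := gsum_pair (X := V) (F := id1 (V : K)) (typed_id2 (tTn V 1 * id1 (V : K))).
      rewrite !rw1 comp1r !(vcomp_idr (typed_tpr V _)).
      by rewrite (vcomp_idr (s_typed (tangentP (tstruct V)))).
    have t1 := typed_tpi1 V; have t2 := typed_tpi2 V.
    have fibU : fibred (U * tTn V 1) U (U <* tpi1 V) (U <* tpi2 V).
      split; rewrite ?(strict_T sU); [typ | typ |].
      by rewrite -(strict_p sU) -!lw_vcomp; [rewrite (tp_tpr V o20 o21) | ends..].
    rewrite lw_vcomp; last by ends.
    rewrite es (strict_gsum sU fib) comp1r (gsum_pre fibU tUk).
    rewrite -!lw_vcomp; try by ends.
    rewrite !e.
    have := gsum_pair (X := X) (F := U : mor V X) (typed_id2 (tTn X 1 * U)).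
    rewrite !(vcomp_idr (typed_rw U (typed_tpr X _))) => ->.
    by rewrite (vcomp_idr (typed_rw U (s_typed (tangentP (tstruct X))))).
  + exact: strict_l.
  + exact: strict_c.
Qed.

(** The projections of a 2-pullback preserve the new choice of pullbacks; here they
    are seen as strict morphisms into V with its original choice. *)
Lemma changed_strict (H : nat -> mor V V) (k : nat -> cell V V)
    (P : tangentad K) (F : mor P V) : typed (k 1) (H 1) (tTn V 1) ->
  preserves (tstruct P) (changed_data H k) F ->
  isLax (X := P) (Y := V) F (id2 (F * tT P)).
Proof.
move=> tk [eT eTn epr ep ez es el ec]; apply: isLax_of_cells => //.
rewrite [LHS]es [F <* tpi1 P]epr [F <* tpi2 P]epr /=.
have t1 := typed_tpi1 V; have t2 := typed_tpi2 V.
rewrite !rw_vcomp; try by ends.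
by rewrite (gsum_pair (G := H 1 * F)) //; typ.
Qed.

End VectorFieldArithmetic.

Section AdditiveBundle.
Local Open Scope cat_scope.
Variables (K : twoCat) (X : tangentad K) (C : vfConstruction X).
Let V : tangentad K := VF C.
Let U : strict V X := VFU C.
Let v : cell V X := ucell C.
Variables (Vn : nat -> tangentad K) (pi : forall n, 'I_n.+1 -> strict (Vn n) V).
Hypothesis HP : forall n, is_nfold_2pullback (fun k => lmor (pi (n := n) k)) U.
Variables (zero : strict X V) (add : strict (Vn 1) V).
Hypothesis zeroU : (U * zero)%K2 = id1 (X : K).
Hypothesis zerov : (v *> zero)%K2 = tz X.
Hypothesis addU : (U * add)%K2 = (U * pi o20)%K2.
Hypothesis addv : (v *> add)%K2 =
  gsum (U * pi o20)%K2 (v *> pi o20)%K2 (v *> pi o21)%K2.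

Lemma nfold_TngS n : @is_nfold_pullback (TngS K) V X (Vn n) n (@pi n) U.
Proof.
split.
  by move=> i j; apply: strict_eq; exact: (twopb_eq (HP n)).
move=> Z f ef.
have [_ univ _] := strict_2pullback (HP n).
have [|H [eH uH]] := univ Z (fun k => slax (f k)).
  by move=> i j; exact: (congr1 (@slax _ _ _) (ef i j)).
have sH : is_strict H.
  by apply: (twopb_strict (HP n)) => k; rewrite eH; exact: strictP.
exists (Strict sH); split.
  by move=> k; apply: strict_eq; exact: (congr1 (@lmor _ _ _) (eH k)).
move=> G eG; apply: strict_eq; congr lmor; apply: uH => k.
exact: (congr1 (@slax _ _ _) (eG k)).
Qed.

Lemma pair_exists (Z : tangentad K) (f g : strict Z V) :
  (U * f)%K2 = (U * g)%K2 ->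
  exists h : strict Z (Vn 1), @is_pair (TngS K) V (Vn 1) Z (@pi 1) f g h.
Proof.
move=> e; have [_ univ] := nfold_TngS 1.
have [|h [eh _]] := univ Z (fun k => if k == 0 :> nat then f else g).
  by move=> i j; apply: strict_eq => /=; case: ifP; case: ifP; rewrite //= e.
by exists h; split; rewrite eh.
Qed.

(** The vector field classified by the sum of f and g is the sum of the vector
    fields that f and g classify. *)
Lemma add_pair (Z : tangentad K) (f g : strict Z V) (h : strict Z (Vn 1)) :
  @is_pair (TngS K) V (Vn 1) Z (@pi 1) f g h ->
  (U * strict_comp add h)%K2 = (U * f)%K2 /\
  (v *> strict_comp add h)%K2 = gsum (U * f)%K2 (v *> f)%K2 (v *> g)%K2.
Proof.
move=> [/= e1 e2].
have {}e1 : lmor f = (pi o20 * h)%K2 by rewrite -e1.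
have {}e2 : lmor g = (pi o21 * h)%K2 by rewrite -e2.
rewrite /= e1 e2 !comp1A addU; split=> //.
rewrite -!rw_rw addv (gsum_rw h (fields_fibred (C := C) _)) //.
exact: (twopb_eq (HP 1)).
Qed.

Lemma additive_bundle : @isAdditiveBundle (TngS K) V X U Vn (@pi) zero add.
Proof.
have eU n (i j : 'I_n.+1) : (U * pi i)%K2 = (U * pi j)%K2 := twopb_eq (HP n) i j.
split.
- exact: nfold_TngS.
- exact: strict_eq.
- exact: strict_eq.
- move=> rho1 rho2 rho3.
  have [a ha] : exists a : strict (Vn 2) (Vn 1), is_pair (C := TngS K) (@pi 1) rho1 rho2 a.
    by apply: pair_exists; exact: eU.
  have [b hb] : exists b : strict (Vn 2) (Vn 1), is_pair (C := TngS K) (@pi 1) rho2 rho3 b.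
    by apply: pair_exists; exact: eU.
  have [aU av] := add_pair ha; have [bU bv] := add_pair hb.
  have e12 : (U * rho2)%K2 = (U * rho1)%K2 by exact: eU.
  have e23 : (U * rho3)%K2 = (U * rho2)%K2 by exact: eU.
  have [h hh] : exists h : strict (Vn 2) (Vn 1),
      is_pair (C := TngS K) (@pi 1) (strict_comp add a) rho3 h.
    by apply: pair_exists; rewrite aU e23 e12.
  have [h' hh'] : exists h : strict (Vn 2) (Vn 1),
      is_pair (C := TngS K) (@pi 1) rho1 (strict_comp add b) h.
    by apply: pair_exists; rewrite bU e12.
  exists a, b, h, h'; split=> //.
  have [hU hv] := add_pair hh; have [hU' hv'] := add_pair hh'.
  apply: VF_strict_inj; first by rewrite hU hU' aU.
  rewrite hv hv' av bv aU e12.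
  have f12 := fields_fibred (C := C) e12; have f23 := fields_fibred (C := C) e23.
  rewrite e12 in f23.
  exact: gsum_assoc f12 f23.
- have e10 : (U * pi (n := 1) o21)%K2 = (U * pi (n := 1) o20)%K2 by exact: eU.
  have [h hh] := pair_exists e10; exists h => //.
  have [hU hv] := add_pair hh.
  apply: VF_strict_inj; first by rewrite hU addU e10.
  rewrite hv addv e10; apply: gsum_comm; exact: (fields_fibred (C := C) e10).
- have e : (U * strict_comp zero U)%K2 = (U * strict_id V)%K2.
    by rewrite /= comp1A zeroU comp1l comp1r.
  have [h hh] := pair_exists e; exists h => //.
  have [hU hv] := add_pair hh.
  apply: VF_strict_inj; first by rewrite hU.
  rewrite hv e /= comp1r rw1 -rw_rw zerov.
  have := gsum_unit (ucell_typed C); rewrite ucell_p.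
  by rewrite (vcomp_idr (F := U) (G := (tT X * U)%K2)) //; split; ends.
Qed.

End AdditiveBundle.

(* [VFn Y n] is the (n+1)-fold 2-pullback VF_{n+1}(Y). *)
Theorem theorem3p13 (K : twoCat)
    (VFc : forall Y : tangentad K, vfConstruction Y)
    (VFn : tangentad K -> nat -> K)
    (proj : forall (Y : tangentad K) (n : nat), 'I_n.+1 -> mor (VFn Y n) (VF (VFc Y)))
    (HVFn : forall (Y : tangentad K) (n : nat),
        is_nfold_2pullback (proj Y n) (VFU (VFc Y)))
    (X : tangentad K) :
  let V : tangentad K := VF (VFc X) in
  let U : strict V X := VFU (VFc X) in
  exists S : forall n : nat, tangentStructure (VFn X n),
  let Vn (n : nat) : tangentad K := Tangentad (S n) in
  exists (pi : forall n : nat, 'I_n.+1 -> strict (Vn n) V)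
         (zero : strict X V) (add : strict (Vn 1) V),
  [/\ forall (n : nat) (k : 'I_n.+1), lmor (pi n k) = proj X n k,
      forall n : nat, is_nfold_2pullback_Tng (fun k : 'I_n.+1 => slax (pi n k)) U,
      Gamma (VFv (VFc X)) X zero = vf_zero X,
      is_vf_sum (Gamma (VFv (VFc X)) (Vn 1) (pi 1 (@Ordinal 2 0 isT)))
                (Gamma (VFv (VFc X)) (Vn 1) (pi 1 (@Ordinal 2 1 isT)))
                (Gamma (VFv (VFc X)) (Vn 1) add)
    & @isAdditiveBundle (TngS K) V X U Vn pi zero add].
Proof.
move=> V U.
have [H [k [tk TE pU]]] := VF_changed (VFc X).
pose D n := projT1 (boolp.cid (twopb_data (HVFn X n) pU)).
have pD n i : preserves (D n) (changed_data H k) (proj X n i).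
  by rewrite /D; case: boolp.cid.
have TD n : isTangent (D n).
  exact: (twopb_tangent (HVFn X n) TE (tangentP (tstruct X)) pU (pD n)).
pose S n := TangentStructure (TD n).
exists S; set Vn := fun n => Tangentad (S n).
pose pi n (i : 'I_n.+1) : strict (Vn n) V :=
  @Strict K (Vn n) V (Lax (changed_strict (P := Vn n) (tk 1) (pD n i))) erefl.
have HP n : is_nfold_2pullback (fun i => lmor (pi n i)) U := HVFn X n.
have [zero [Gzero [zeroU zerov]]] := zero_exists (VFc X).
have [add [Gadd addU addv]] := sum_exists (twopb_eq (HP 1) o21 o20).
exists pi, zero, add; split=> //.
- by move=> n; exact: strict_2pullback (HP n).
- exact: additive_bundle.
Qed.
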